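(* Let $K$ be a field of characteristic zero and let $\mathbb{I}_1 = K\langle x, \partial, \int\rangle$ be the algebra of polynomial integro-differential operators in one variable. Then: 1. $\mathrm{l.gldim}(Q_l(\mathbb{I}_1)) = 1$, where $Q_l(\mathbb{I}_1)$ is the largest left quotient ring of $\mathbb{I}_1$. 2. For every regular left Ore set $S$ of $\mathbb{I}_1$, $\mathrm{l.gldim}(S^{-1}\mathbb{I}_1) = 1$.
   Context: $\mathbb{I}_1$ is the $K$-subalgebra of $\mathrm{End}_K(K[x])$ generated by multiplication by $x$, the derivation $\partial = d/dx$, and the integration $\int : x^{m}\mapsto \frac{x^{m+1}}{m+1}$ ($m\ge 0$). An element of a ring $R$ is regular if it is neither a left nor a right zero divisor. A multiplicatively closed subset $S$ of $R$ is a left Ore set if $Sr\cap Rs\neq\emptyset$ for all $r\in R$, $s\in S$; it is a regular left Ore set if moreover all its elements are regular. In that case $S^{-1}R$ denotes the left localization (left ring of fractions) of $R$ at $S$. Every ring $R$ has a largest (with respect to inclusion) left Ore set consisting of regular elements, denoted $S_l(R)$. The ring $Q_l(R) := S_l(R)^{-1}R$ is called the (largest) left quotient ring of $R$. $\mathrm{l.gldim}$ denotes left global dimension. *)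

(* Defs.v *)
From HB Require Import structures.
From mathcomp Require Import all_boot all_algebra.
From mathcomp Require Import boolp classical_sets.

Set Implicit Arguments.
Unset Strict Implicit.
Unset Printing Implicit Defensive.

Import GRing.Theory.

Local Open Scope quotient_scope.
Local Open Scope classical_set_scope.
Local Open Scope ring_scope.

(* The product on End_K(K[x]) is composition, (f * g) p = f (g p). *)
Definition polyEnd (K : fieldType) : Type := {linear {poly K} -> {poly K}}.

Section PolyEnd.
Variable K : fieldType.
Local Notation E := (polyEnd K).
Implicit Types f g h : E.

Definition polyEnd_fun f : {poly K} -> {poly K} := f.

HB.instance Definition _ := gen_eqMixin E.
HB.instance Definition _ := gen_choiceMixin E.

Lemma polyEndP f g : polyEnd_fun f =1 polyEnd_fun g -> f = g.
Proof.
case: f g => f [[f1] [f2]] [g [[g1] [g2]]]; rewrite /polyEnd_fun /= => fg.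
have {}fg : f = g by apply: funext => p; apply: fg.
by subst g; congr GRing.Linear.Pack; congr GRing.Linear.Class;
  congr (_ _); apply: Prop_irrelevance.
Qed.

Definition endAdd f g : E := f \+ g.
Definition endOpp f : E := \- f.
Definition endZero : E := \0.
Definition endOne : E := idfun.
Definition endMul f g : E := f \o g.
Definition endScale (a : K) f : E := a \*: f.

Fact endAddA : associative endAdd.
Proof. by move=> f g h; apply: polyEndP => p; apply: addrA. Qed.
Fact endAddC : commutative endAdd.
Proof. by move=> f g; apply: polyEndP => p; apply: addrC. Qed.
Fact endAdd0 : left_id endZero endAdd.
Proof. by move=> f; apply: polyEndP => p; apply: add0r. Qed.
Fact endAddN : left_inverse endZero endOpp endAdd.
Proof. by move=> f; apply: polyEndP => p; apply: addNr. Qed.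

HB.instance Definition _ :=
  GRing.isZmodule.Build E endAddA endAddC endAdd0 endAddN.

Fact endMulA : associative endMul.
Proof. by move=> f g h; apply: polyEndP. Qed.
Fact endMul1 : left_id endOne endMul.
Proof. by move=> f; apply: polyEndP. Qed.
Fact endMulr1 : right_id endOne endMul.
Proof. by move=> f; apply: polyEndP. Qed.
Fact endMulDl : left_distributive endMul endAdd.
Proof. by move=> f g h; apply: polyEndP. Qed.
Fact endMulDr : right_distributive endMul endAdd.
Proof. by move=> f g h; apply: polyEndP => p; apply: (linearD f). Qed.
Fact endOne_neq0 : endOne != 0.
Proof.
apply/eqP => /(congr1 (fun f => polyEnd_fun f 1)) /eqP.
by rewrite /polyEnd_fun /= oner_eq0.
Qed.

HB.instance Definition _ := GRing.Zmodule_isNzRing.Build E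
  endMulA endMul1 endMulr1 endMulDl endMulDr endOne_neq0.

Fact endScaleA a b f : endScale a (endScale b f) = endScale (a * b) f.
Proof. by apply: polyEndP => p; apply: scalerA. Qed.
Fact endScale1 : left_id 1 endScale.
Proof. by move=> f; apply: polyEndP => p; apply: scale1r. Qed.
Fact endScaleDr : right_distributive endScale +%R.
Proof. by move=> a f g; apply: polyEndP => p; apply: scalerDr. Qed.
Fact endScaleDl f : {morph endScale^~ f : a b / a + b}.
Proof. by move=> a b; apply: polyEndP => p; apply: scalerDl. Qed.

HB.instance Definition _ := GRing.Zmodule_isLmodule.Build K E
  endScaleA endScale1 endScaleDr endScaleDl.

Fact endScaleAl (a : K) f g : a *: (f * g) = (a *: f) * g.
Proof. by apply: polyEndP. Qed.
HB.instance Definition _ := GRing.Lmodule_isLalgebra.Build K E endScaleAl.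

Fact endScaleAr (a : K) f g : a *: (f * g) = f * (a *: g).
Proof. by apply: polyEndP => p; rewrite /polyEnd_fun /= linearZ. Qed.
HB.instance Definition _ := GRing.Lalgebra_isAlgebra.Build K E endScaleAr.

Definition mulX_fun (p : {poly K}) : {poly K} := 'X * p.
Definition int_fun (p : {poly K}) : {poly K} :=
  \sum_(i < size p) (p`_i / i.+1%:R) *: 'X^(i.+1).

Fact mulX_linear : linear mulX_fun.
Proof. by move=> a p q; rewrite /mulX_fun mulrDr scalerAr. Qed.
HB.instance Definition _ :=
  GRing.isLinear.Build K {poly K} {poly K} _ mulX_fun mulX_linear.

Lemma int_funE n (p : {poly K}) : (size p <= n)%N ->
  int_fun p = \sum_(i < n) (p`_i / i.+1%:R) *: 'X^(i.+1).
Proof.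
move=> le_pn; rewrite /int_fun (big_ord_widen n
  (fun i => (p`_i / i.+1%:R) *: 'X^(i.+1)) le_pn) big_mkcond /=.
apply: eq_bigr => i _; case: ltnP => // le_pi.
by rewrite nth_default // mul0r scale0r.
Qed.

Fact int_linear : linear int_fun.
Proof.
move=> a p q; pose n := maxn (size p) (size q).
have le_pq : (size (a *: p + q)%R <= n)%N.
  apply: leq_trans (size_polyD _ _) _.
  by rewrite geq_max leq_maxr (leq_trans (size_scale_leq _ _)) ?leq_maxl.
rewrite !(@int_funE n) ?leq_maxl ?leq_maxr // scaler_sumr -big_split /=.
by apply: eq_bigr => i _; rewrite coefD coefZ mulrDl scalerDl -mulrA scalerA.
Qed.
HB.instance Definition _ :=
  GRing.isLinear.Build K {poly K} {poly K} _ int_fun int_linear.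

Lemma int_Xn m : int_fun 'X^m = m.+1%:R^-1 *: 'X^(m.+1).
Proof.
rewrite (@int_funE m.+1) ?size_polyXn // big_ord_recr /= big1 => [|i _].
  by rewrite add0r coefXn eqxx mul1r.
by rewrite coefXn (ltn_eqF (ltn_ord i)) mul0r scale0r.
Qed.

Definition opX : E := mulX_fun.
Definition opD : E := @deriv K.
Definition opInt : E := int_fun.

Definition I1_pred : {pred E} := fun a =>
  `[< forall A : {pred E}, subalg_closed A ->
        opX \in A -> opD \in A -> opInt \in A -> a \in A >].

Fact I1_subalg : subalg_closed I1_pred.
Proof.
split=> [|a u v /asboolP uP /asboolP vP|u v /asboolP uP /asboolP vP];
  apply/asboolP => A Aalg AX AD AI; have [A1 Al AM] := Aalg => //.
  by apply: Al; [apply: uP | apply: vP].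
by apply: AM; [apply: uP | apply: vP].
Qed.
HB.instance Definition _ := GRing.isSubalgClosed.Build K E I1_pred
  I1_subalg.

End PolyEnd.

Record I1 (K : fieldType) := MkI1 {I1_val : polyEnd K; _ : I1_val \in @I1_pred K}.

Section I1Algebra.
Variable K : fieldType.
HB.instance Definition _ := [isSub for @I1_val K].
HB.instance Definition _ := [Choice of I1 K by <:].
HB.instance Definition _ := [SubChoice_isSubAlgebra of I1 K by <:].
End I1Algebra.

Section OreSets.
Variable R : nzRingType.
Implicit Types (S T : set R) (r s t : R).

Definition regular s : Prop := GRing.lreg s /\ GRing.rreg s.

Definition mult_closed S : Prop := S 1 /\ forall s t, S s -> S t -> S (s * t).

(* The Ore condition says that the sets S r and R s meet. *)
Definition left_Ore S : Prop :=
  mult_closed S /\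
  forall r s, S s -> exists t q, S t /\ t * r = q * s.

Definition regular_left_Ore S : Prop :=
  left_Ore S /\ forall s, S s -> regular s.

(* The union of all regular left Ore sets; by [S_lP] it is the largest one. *)
Definition S_l : set R := [set s | exists2 S, regular_left_Ore S & S s].

Inductive ore_gen : R -> Prop :=
| Ore_gen1 : ore_gen 1
| Ore_genM S s t : regular_left_Ore S -> S s -> ore_gen t -> ore_gen (s * t).

Lemma ore_gen_sub S : regular_left_Ore S -> S `<=` ore_gen.
Proof. by move=> HS s Ss; rewrite -[s]mulr1; apply: Ore_genM HS Ss Ore_gen1. Qed.

Lemma ore_genM s t : ore_gen s -> ore_gen t -> ore_gen (s * t).
Proof.
elim=> [|S s1 s2 HS Ss1 _ IH] tG; first by rewrite mul1r.
by rewrite -mulrA; apply: Ore_genM HS Ss1 (IH tG).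
Qed.

Lemma ore_gen_Ore : regular_left_Ore ore_gen.
Proof.
split; first split.
- by split; [exact: Ore_gen1 | exact: ore_genM].
- move=> r s sG; elim: sG r => [|S s1 s2 HS Ss1 _ IH] r.
    by exists 1, r; split; [exact: Ore_gen1 | rewrite mul1r mulr1].
  have [t2 [q2 [t2G e2]]] := IH r.
  have [t1 [q1 [St1 e1]]] := HS.1.2 q2 s1 Ss1.
  exists (t1 * t2), q1; split; first by apply: Ore_genM HS St1 t2G.
  by rewrite -mulrA e2 mulrA e1 mulrA.
- move=> s; elim=> [|S s1 s2 HS Ss1 _ [l2 r2]].
    by split; [exact: GRing.lreg1 | exact: GRing.rreg1].
  have [l1 r1] := HS.2 _ Ss1.
  by split; [exact: GRing.lregM | exact: GRing.rregM].
Qed.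

Lemma S_l_max S : regular_left_Ore S -> S `<=` S_l.
Proof. by move=> HS s Ss; exists S. Qed.

Lemma S_l_regular_left_Ore : regular_left_Ore S_l.
Proof.
suff -> : S_l = ore_gen by exact: ore_gen_Ore.
rewrite eqEsubset; split; last exact: (S_l_max ore_gen_Ore).
by move=> s [S HS Ss]; apply: (ore_gen_sub HS).
Qed.

Lemma S_lP :
  regular_left_Ore S_l /\ forall S, regular_left_Ore S -> S `<=` S_l.
Proof. by split; [exact: S_l_regular_left_Ore | exact: S_l_max]. Qed.

End OreSets.

Section Fractions.
Variables (R : nzRingType) (S : set R) (HS : regular_left_Ore S).

(* The pair (s, r) stands for the left fraction s^-1 r. *)
Definition lpair : Type := (set_type S * R)%type.
HB.instance Definition _ := Choice.on lpair.

Implicit Types (x y z : lpair) (a b c : R).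

Definition den x : R := val x.1.
Definition num x : R := x.2.
Definition MkPair s r (Ss : S s) : lpair := (SigSub (mem_set Ss), r).

Lemma denP x : S (den x). Proof. exact/set_mem/valP. Qed.

Definition frac_rel x y : Prop := exists c d,
  [/\ S (c * den x), c * den x = d * den y & c * num x = d * num y].

Definition frac_eqb x y : bool := `[< frac_rel x y >].

(* acts x a b says that a (s^-1 r) = b where x = (s, r). *)
Definition acts x a b : Prop :=
  exists t c, [/\ S t, t * a = c * den x & t * b = c * num x].

Let S1 : S 1 := HS.1.1.1.
Let SM : forall s t, S s -> S t -> S (s * t) := HS.1.1.2.
Let Ore : forall r s, S s -> exists t q, S t /\ t * r = q * s := HS.1.2.
Let Sl s : S s -> GRing.lreg s. Proof. by move=> /HS.2[]. Qed.
Let Sr s : S s -> GRing.rreg s. Proof. by move=> /HS.2[]. Qed.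

Lemma acts_self x : acts x (den x) (num x).
Proof. by exists 1, 1. Qed.

Lemma actsD x a a' b b' : acts x a b -> acts x a' b' -> acts x (a + a') (b + b').
Proof.
move=> [t [c [St ea eb]]] [t' [c' [St' ea' eb']]].
have [v [w [Sv e]]] := Ore t St'.
exists (v * t), (v * c + w * c'); split; first exact: SM.
  rewrite mulrDr -mulrA ea mulrDl; congr (_ + _); first by rewrite mulrA.
  by rewrite e -mulrA ea' mulrA.
rewrite mulrDr -mulrA eb mulrDl; congr (_ + _); first by rewrite mulrA.
by rewrite e -mulrA eb' mulrA.
Qed.

Lemma actsM x d a b : acts x a b -> acts x (d * a) (d * b).
Proof.
move=> [t [c [St ea eb]]]; have [v [w [Sv e]]] := Ore d St.
by exists v, (w * c); split=> //; rewrite mulrA e -mulrA ?ea ?eb mulrA.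
Qed.

Lemma acts_cancel x s a b : S s -> acts x (s * a) (s * b) -> acts x a b.
Proof.
move=> Ss [t [c [St ea eb]]].
by exists (t * s), c; split; [exact: SM | rewrite -mulrA | rewrite -mulrA].
Qed.

Lemma acts0 x b : acts x 0 b -> b = 0.
Proof.
move=> [t [c [St ea eb]]]; apply: (Sl St); rewrite mulr0 eb.
suff -> : c = 0 by rewrite mul0r.
by apply: (Sr (denP x)); rewrite mul0r -ea mulr0.
Qed.

Lemma acts_fun x a b b' : acts x a b -> acts x a b' -> b = b'.
Proof.
move=> e e'; apply/eqP; rewrite -subr_eq0; apply/eqP; apply: (@acts0 x).
have := actsD e (actsM (- 1) e'); by rewrite !mulN1r subrr.
Qed.

Lemma acts_dom x a : exists s b, S s /\ acts x (s * a) b.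
Proof.
have [v [w [Sv e]]] := Ore a (denP x).
by exists v, (w * num x); split; rewrite // e; apply/actsM/acts_self.
Qed.

Lemma frac_relP x y : frac_rel x y <-> acts y (den x) (num x).
Proof.
split=> [[c [d [Sc e1 e2]]] | [t [c [St e1 e2]]]]; last first.
  by exists t, c; split=> //; apply: SM => //; apply: denP.
have [v [w [Sv]]] := Ore (den x) Sc; rewrite mulrA => /(Sr (denP x)) ev.
apply: (acts_cancel Sv); rewrite ev -!mulrA e1 e2.
by do 2!apply: actsM; apply: acts_self.
Qed.

Lemma acts_sub x y a b : acts y (den x) (num x) -> acts x a b -> acts y a b.
Proof.
by move=> xy [t [c [St ea eb]]]; apply: (acts_cancel St); rewrite ea eb;
  apply: actsM.
Qed.

Lemma frac_rel_sym x y : frac_rel x y -> frac_rel y x.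
Proof. by move=> [c [d [Sc e1 e2]]]; exists d, c; rewrite -e1. Qed.

Fact frac_eqb_refl : reflexive frac_eqb.
Proof. by move=> x; apply/asboolP/frac_relP/acts_self. Qed.
Fact frac_eqb_sym : symmetric frac_eqb.
Proof.
by move=> x y; apply/idP/idP => /asboolP /frac_rel_sym /asboolP.
Qed.
Fact frac_eqb_trans : transitive frac_eqb.
Proof.
move=> y x z /asboolP/frac_relP xy /asboolP/frac_relP yz.
by apply/asboolP/frac_relP; apply: acts_sub yz xy.
Qed.

Canonical frac_equiv :=
  EquivRel frac_eqb frac_eqb_refl frac_eqb_sym frac_eqb_trans.

Definition lfrac : Type := {eq_quot frac_eqb}.
HB.instance Definition _ : EqQuotient _ frac_eqb lfrac := EqQuotient.on lfrac.
HB.instance Definition _ := Choice.on lfrac.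

Definition mkfrac s r (Ss : S s) : lfrac := \pi_lfrac (MkPair r Ss).

Lemma ore_sig r s : S s -> {tq : R * R | S tq.1 & tq.1 * r = tq.2 * s}.
Proof.
move=> Ss; apply: cid2; have [t [q [St e]]] := Ore r Ss.
by exists (t, q).
Qed.

Definition ore_den r s (Ss : S s) : R := (s2val (ore_sig r Ss)).1.
Definition ore_num r s (Ss : S s) : R := (s2val (ore_sig r Ss)).2.

Lemma ore_denP r s (Ss : S s) : S (ore_den r Ss).
Proof. exact: s2valP (ore_sig r Ss). Qed.
Lemma ore_eq r s (Ss : S s) : ore_den r Ss * r = ore_num r Ss * s.
Proof. exact: s2valP' (ore_sig r Ss). Qed.

(* With t s1 = q s2, t in S:  s1^-1 r1 + s2^-1 r2 = (t s1)^-1 (t r1 + q r2). *)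
Definition add_pair x y : lpair :=
  let t := ore_den (den x) (denP y) in
  let q := ore_num (den x) (denP y) in
  MkPair (t * num x + q * num y) (SM (ore_denP (den x) (denP y)) (denP x)).

(* With t r1 = q s2, t in S:  (s1^-1 r1) (s2^-1 r2) = (t s1)^-1 (q r2). *)
Definition mul_pair x y : lpair :=
  let q := ore_num (num x) (denP y) in
  MkPair (q * num y) (SM (ore_denP (num x) (denP y)) (denP x)).

Definition lfrac0 : lfrac := mkfrac 0 S1.
Definition lfrac1 : lfrac := mkfrac 1 S1.
Definition lfrac_opp (u : lfrac) : lfrac :=
  mkfrac (- num (repr u)) (denP (repr u)).
Definition lfrac_add (u v : lfrac) : lfrac :=
  \pi_lfrac (add_pair (repr u) (repr v)).
Definition lfrac_mul (u v : lfrac) : lfrac :=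
  \pi_lfrac (mul_pair (repr u) (repr v)).

Implicit Types u v w : lfrac.

(* act u a b says that a u = b in lfrac. *)
Definition act u := acts (repr u).

Lemma den_MkPair s r (Ss : S s) : den (MkPair r Ss) = s.
Proof. by []. Qed.
Lemma num_MkPair s r (Ss : S s) : num (MkPair r Ss) = r.
Proof. by []. Qed.

Lemma act_pi x : act (\pi_lfrac x) (den x) (num x).
Proof.
by apply/frac_relP/asboolP; have /eqmodP : x = repr (\pi_lfrac x) %[mod lfrac]
  by rewrite reprK.
Qed.

Lemma act_mkfrac s r (Ss : S s) : act (mkfrac r Ss) s r.
Proof. exact: act_pi (MkPair r Ss). Qed.

Lemma act_eq_mkfrac u s r (Ss : S s) : act u s r -> u = mkfrac r Ss.
Proof.
move=> us; rewrite -[u]reprK; apply/esym/eqmodP/asboolP/frac_relP.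
exact: us.
Qed.

Lemma act_ext u v s b : S s -> act u s b -> act v s b -> u = v.
Proof. by move=> Ss /(act_eq_mkfrac Ss) -> /(act_eq_mkfrac Ss) ->. Qed.

Lemma act_dom u a : exists s b, S s /\ act u (s * a) b.
Proof. exact: acts_dom. Qed.

Lemma actZ u d a b : act u a b -> act u (d * a) (d * b).
Proof. exact: actsM. Qed.

Lemma act_fun u a b c : act u a b -> act u a c -> b = c.
Proof. exact: acts_fun. Qed.

Lemma act_repr u d e :
  act u (d * (e * den (repr u))) (d * (e * num (repr u))).
Proof. by do 2!apply: actZ; apply: acts_self. Qed.

Lemma act_add u v a b c : act u a b -> act v a c -> act (lfrac_add u v) a (b + c).
Proof.
move=> ub vc; have := act_pi (add_pair (repr u) (repr v)).
rewrite /add_pair den_MkPair num_MkPair -/(lfrac_add u v).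
set t := ore_den _ _; set q := ore_num _ _ => H.
have e : t * den (repr u) = q * den (repr v) by exact: ore_eq.
have Ss : S (t * den (repr u)) by apply: SM; [exact: ore_denP | exact: denP].
have [k [l [Sk ek]]] := Ore a Ss.
have eb : k * b = l * (t * num (repr u)).
  by apply: (act_fun (actZ k ub)); rewrite ek; apply: act_repr.
have ec : k * c = l * (q * num (repr v)).
  by apply: (act_fun (actZ k vc)); rewrite ek e; apply: act_repr.
by apply: (acts_cancel Sk); rewrite ek mulrDr eb ec -mulrDr; apply: actsM.
Qed.

Lemma act_mul u v a b c : act u a b -> act v b c -> act (lfrac_mul u v) a c.
Proof.
move=> ub vc; have := act_pi (mul_pair (repr u) (repr v)).
rewrite /mul_pair den_MkPair num_MkPair -/(lfrac_mul u v).
set t := ore_den _ _; set q := ore_num _ _ => H.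
have e : t * num (repr u) = q * den (repr v) by exact: ore_eq.
have Ss : S (t * den (repr u)) by apply: SM; [exact: ore_denP | exact: denP].
have [k [l [Sk ek]]] := Ore a Ss.
have eb : k * b = l * (q * den (repr v)).
  by rewrite -e; apply: (act_fun (actZ k ub)); rewrite ek; apply: act_repr.
have ec : k * c = l * (q * num (repr v)).
  by apply: (act_fun (actZ k vc)); rewrite eb; apply: act_repr.
by apply: (acts_cancel Sk); rewrite ek ec; apply: actsM.
Qed.

Lemma act_const r (S1' : S 1) a : act (mkfrac r S1') a (a * r).
Proof. by rewrite -{1}[a]mulr1; apply: actZ; apply: act_mkfrac. Qed.

Lemma act_opp u a b : act u a b -> act (lfrac_opp u) a (- b).
Proof.
move=> [t [c [St ea eb]]]; apply: (acts_cancel St).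
by rewrite ea mulrN eb -mulrN; apply: actsM; apply: act_mkfrac.
Qed.

Lemma act_dom1 u : exists s b, S s /\ act u s b.
Proof. by have [s [b]] := act_dom u 1; rewrite mulr1; exists s, b. Qed.

Lemma act_dom2 u v : exists s b c, [/\ S s, act u s b & act v s c].
Proof.
have [s [b [Ss us]]] := act_dom1 u; have [t [c [St vt]]] := act_dom v s.
by exists (t * s), (t * b), c; split; [exact: SM | exact: actZ |].
Qed.

Lemma act_dom3 u v w :
  exists s b c d, [/\ S s, act u s b, act v s c & act w s d].
Proof.
have [s [b [c [Ss us vs]]]] := act_dom2 u v.
have [t [d [St wt]]] := act_dom w s.
by exists (t * s), (t * b), (t * c), d; split; [exact: SM | exact: actZ | exact: actZ |].
Qed.

Fact lfrac_addA : associative lfrac_add.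
Proof.
move=> u v w; have [s [b [c [d [Ss us vs ws]]]]] := act_dom3 u v w.
apply: (act_ext Ss (b := b + c + d)).
  by rewrite -addrA; apply: act_add us (act_add vs ws).
exact: act_add (act_add us vs) ws.
Qed.
Fact lfrac_addC : commutative lfrac_add.
Proof.
move=> u v; have [s [b [c [Ss us vs]]]] := act_dom2 u v.
by apply: (act_ext Ss (b := b + c)); [|rewrite addrC]; apply: act_add.
Qed.
Fact lfrac_add0 : left_id lfrac0 lfrac_add.
Proof.
move=> u; have [s [b [Ss us]]] := act_dom1 u.
apply: (act_ext Ss _ us); rewrite -[b]add0r; apply: act_add _ us.
by rewrite -[X in act _ _ X](mulr0 s); apply: act_const.
Qed.
Fact lfrac_addN : left_inverse lfrac0 lfrac_opp lfrac_add.
Proof.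
move=> u; have [s [b [Ss us]]] := act_dom1 u.
apply: (act_ext Ss (b := 0)).
  rewrite -(addNr b); exact: act_add (act_opp us) us.
by rewrite -[X in act _ _ X](mulr0 s); apply: act_const.
Qed.
HB.instance Definition _ := GRing.isZmodule.Build lfrac
  lfrac_addA lfrac_addC lfrac_add0 lfrac_addN.

Lemma act_chain u v : exists s b c, [/\ S s, act u s b & act v b c].
Proof.
have [s [b [Ss us]]] := act_dom1 u; have [t [c [St vt]]] := act_dom v b.
by exists (t * s), (t * b), c; split; [exact: SM | exact: actZ |].
Qed.

Fact lfrac_mulA : associative lfrac_mul.
Proof.
move=> u v w; have [s [b [c [Ss us vs]]]] := act_chain u v.
have [t [d [St wt]]] := act_dom w c.
have ut := actZ t us; have vt := actZ t vs.
apply: (act_ext (SM St Ss) (b := d)).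
  exact: act_mul ut (act_mul vt wt).
exact: act_mul (act_mul ut vt) wt.
Qed.
Fact lfrac_mul1l : left_id lfrac1 lfrac_mul.
Proof.
move=> u; have [s [b [Ss us]]] := act_dom1 u.
apply: (act_ext Ss _ us); apply: act_mul _ us.
by rewrite -[X in act _ _ X]mulr1; apply: act_const.
Qed.
Fact lfrac_mul1r : right_id lfrac1 lfrac_mul.
Proof.
move=> u; have [s [b [Ss us]]] := act_dom1 u.
apply: (act_ext Ss _ us); apply: act_mul us _.
by rewrite -[X in act _ _ X]mulr1; apply: act_const.
Qed.
Fact lfrac_mulDl : left_distributive lfrac_mul lfrac_add.
Proof.
move=> u v w; have [s [b [c [Ss us vs]]]] := act_dom2 u v.
have [t [d [St wt]]] := act_dom w b; have [k [e [Sk we]]] := act_dom w (t * c).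
have ut := actZ k (actZ t us); have vt := actZ k (actZ t vs).
have wkt := actZ k wt.
apply: (act_ext (SM Sk (SM St Ss)) (b := k * d + e)).
  exact: act_mul (act_add ut vt) (actsD wkt we).
exact: act_add (act_mul ut wkt) (act_mul vt we).
Qed.
Fact lfrac_mulDr : right_distributive lfrac_mul lfrac_add.
Proof.
move=> u v w; have [s [b [Ss us]]] := act_dom1 u.
have [t [c [St vt]]] := act_dom v b; have [k [d [Sk wk]]] := act_dom w (t * b).
have ut := actZ k (actZ t us); have vkt := actZ k vt.
apply: (act_ext (SM Sk (SM St Ss)) (b := k * c + d)).
  exact: act_mul ut (act_add vkt wk).
exact: act_add (act_mul ut vkt) (act_mul ut wk).
Qed.
Fact lfrac1_neq0 : lfrac1 != lfrac0.
Proof.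
apply/eqP => e; have := act_const 0 S1 1; rewrite -/lfrac0 -e => h.
have := act_fun h (act_const 1 S1 1); rewrite mulr0 mulr1 => /esym/eqP.
by rewrite oner_eq0.
Qed.
HB.instance Definition _ := GRing.Zmodule_isNzRing.Build lfrac
  lfrac_mulA lfrac_mul1l lfrac_mul1r lfrac_mulDl lfrac_mulDr lfrac1_neq0.

Definition tolfrac (r : R) : lfrac := mkfrac r S1.

Fact tolfrac_zmod : zmod_morphism tolfrac.
Proof.
move=> r s; apply: (act_ext S1 (act_const _ S1 1)); rewrite mulrBr.
by apply: act_add; [|apply: act_opp]; apply: act_const.
Qed.
Fact tolfrac_monoid : monoid_morphism tolfrac.
Proof.
split=> // r s; apply: (act_ext S1 (act_const _ S1 1)); rewrite mulrA.
by apply: act_mul; apply: act_const.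
Qed.
HB.instance Definition _ :=
  GRing.isZmodMorphism.Build R lfrac tolfrac tolfrac_zmod.
HB.instance Definition _ :=
  GRing.isMonoidMorphism.Build R lfrac tolfrac tolfrac_monoid.

End Fractions.

(* The characteristic properties of a left ring of fractions f : R -> Q of R
   at S; [lfracP] shows that lfrac has them. *)
Definition is_left_fractions (R Q : nzRingType) (S : set R)
    (f : {rmorphism R -> Q}) : Prop :=
  [/\ forall s, S s -> exists q, q * f s = 1 /\ f s * q = 1,
      forall q, exists s r, S s /\ f s * q = f r
    & forall r, f r = 0 <-> exists2 s, S s & s * r = 0].

Lemma lfracP (R : nzRingType) (S : set R) (HS : regular_left_Ore S) :
  is_left_fractions S (tolfrac HS : {rmorphism R -> lfrac HS}).
Proof.
have S1 : S 1 := HS.1.1.1.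
split=> [s Ss|q|r].
- exists (mkfrac HS 1 Ss); split.
    apply: (act_ext Ss (b := s)).
      apply: act_mul; first exact: act_mkfrac.
      by rewrite -[X in act _ _ X]mul1r; apply: act_const.
    by rewrite -[X in act _ _ X]mulr1; apply: act_const.
  apply: (act_ext S1 (b := 1)).
    apply: act_mul; first exact: act_const.
    by rewrite mul1r; apply: act_mkfrac.
  by rewrite -[X in act _ _ X]mulr1; apply: act_const.
- have [s [b [Ss qs]]] := act_dom1 q; exists s, b; split=> //.
  apply: (act_ext S1 (b := b)).
    apply: act_mul; first exact: act_const.
    by rewrite mul1r.
  by rewrite -[X in act _ _ X]mul1r; apply: act_const.
- split=> [e|[s Ss sr]]; last first.
    have /HS.2[l _] := Ss; suff -> : r = 0 by exact: rmorph0.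
    by apply: l; rewrite mulr0.
  exists 1 => //; rewrite mul1r.
  have h : act (tolfrac HS r) 1 (1 * r) by exact: act_const.
  have h0 : act (tolfrac HS 0) 1 (1 * 0) by exact: act_const.
  have e0 : tolfrac HS r = tolfrac HS 0 by exact: e.
  by rewrite e0 in h; move: (act_fun h h0); rewrite mul1r mulr0.
Qed.

Definition Q_l (R : nzRingType) : nzRingType :=
  lfrac (S_l_regular_left_Ore R).

Section Homological.
Variable R : nzRingType.

Definition projective (P : lmodType R) : Prop :=
  forall (A B : lmodType R) (g : {linear A -> B}) (f : {linear P -> B}),
    (forall b, exists a, g a = b) ->
    exists h : {linear P -> A}, forall x, g (h x) = f x.

(* 0 <- M <- P 0 <- P 1 <- ... is exact and all P i are projective. *)
Record proj_resolution (M : lmodType R) := ProjResolution {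
  res_mod : nat -> lmodType R;
  res_d : forall i, {linear res_mod i.+1 -> res_mod i};
  res_aug : {linear res_mod 0%N -> M};
  res_proj : forall i, projective (res_mod i);
  res_aug_surj : forall m, exists x, res_aug x = m;
  res_exact0 : forall x, res_aug x = 0 <-> exists y, res_d 0%N y = x;
  res_exact : forall i x, res_d i x = 0 <-> exists y, res_d i.+1 y = x
}.

Definition pdim_le (M : lmodType R) (n : nat) : Prop :=
  exists P : proj_resolution M,
    forall i, (n < i)%N -> forall x : res_mod P i, x = 0.

End Homological.

(* The least n with P n, and None (standing for infinity) if there is none. *)
Definition least (P : nat -> Prop) : option nat :=
  if pselect (exists n, `[< P n >]) is left exP then Some (ex_minn exP) else None.

Definition pdim (R : nzRingType) (M : lmodType R) : option nat :=
  least (pdim_le M).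

(* The supremum of the projective dimensions of all left modules, as their
   least upper bound in nat extended by None. *)
Definition lgldim (R : nzRingType) : option nat :=
  least (fun n => forall M : lmodType R,
    exists2 m, pdim M = Some m & (m <= n)%N).

(* Main.v *)
From HB Require Import structures.
Require Import Defs.
From mathcomp Require Import all_boot all_algebra.
From mathcomp Require Import boolp classical_sets.
From mathcomp Require Import functions ring zify.

Set Implicit Arguments.
Unset Strict Implicit.
Unset Printing Implicit Defensive.

Import GRing.Theory.

Local Open Scope quotient_scope.
Local Open Scope classical_set_scope.
Local Open Scope ring_scope.

(** Why the theorem holds. A ring is left hereditary when its left ideals are
    projective. Submodules of free modules over such a ring are projective
    ([projOn_submod_free]), so every left module has a projective resolution
    of length one. Left heredity passes to left rings of fractions
    ([left_hereditary_fractions]). It therefore suffices to prove that the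
    algebra I1 is left hereditary ([left_hereditary_I1]) and that its rings of
    fractions have modules that are not projective. The latter holds in every
    ring with elements p, q such that p q = 1 and q p <> 1: the left ideal of
    all r with r q^k = 0 for some k is not a direct summand
    ([quot_power_annihilator_not_pdim0]). In I1 and in its rings of fractions
    the derivation D and the integration J are such elements.

    Left heredity of I1. Let F be the set of the r with D^k r = 0 for some k;
    it is the ideal of the finite-rank operators of I1. As a left module F is
    a direct sum of copies of the simple projective module K[x]; hence its
    submodules are projective and complemented, and a left ideal L is
    projective if and only if L + F is ([projOn_sum_F]). From here on L
    contains F. Every r in I1 satisfies D^k r = sum_i X^i a_i(D) for some k
    and some polynomials a_i ([D_power_diffop]); modulo F the operator D is
    invertible, and I1 / F is the Weyl algebra localized at D.

    If L contains p(D) for some p <> 0 ([projOn_of_dpoly]), take an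
    irreducible factor q of p, say p = p1 q, and induct on the degree of p.
    Commutators with q(D) show that I1 / (I1 q(D) + F) is simple or zero, so
    either L is contained in I1 q(D) + F or L + I1 q(D) = I1. The
    intersection of L with I1 q(D) is isomorphic to a left ideal containing
    p1(D) and F, hence is projective by induction. In the first case L is the
    sum of that intersection and F; in the second case L is projective because
    0 -> L n L' -> L (+) L' -> L + L' -> 0 splits for L' = I1 q(D).

    In general ([common_denominator]), over the field of fractions of K[D]
    the left ideal L becomes principal, generated by an element b of least
    degree in X; a bound on the degrees of generators yields a common
    denominator, that is, elements u, v and a polynomial g <> 0 such that
    b u = g(D) v and L u is contained in I1 v + F. Right multiplications by u
    and v being injective (after multiplying v by a power of D), L u + F is
    isomorphic up to F to the left ideal of the r with r v in L u + F, which
    contains g(D) and is covered by the first case. Injectivity of a right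
    multiplication follows from surjectivity of the operator on K[x], and
    every r outside F becomes surjective after multiplication by a power of D
    ([notF_onto]). *)

(** * Submodules and projectivity *)

Section Submodules.
Variable R : nzRingType.
Implicit Types M A : lmodType R.

Definition submodule M (N : set M) : Prop :=
  N 0 /\ forall a x y, N x -> N y -> N (a *: x + y).

Lemma submodD M (N : set M) x y : submodule N -> N x -> N y -> N (x + y).
Proof. by move=> [_ NL] Nx Ny; rewrite -[x]scale1r; apply: NL. Qed.

Lemma submodZ M (N : set M) a x : submodule N -> N x -> N (a *: x).
Proof. by move=> [N0 NL] Nx; rewrite -[_ *: _]addr0; apply: NL. Qed.

Lemma submodN M (N : set M) x : submodule N -> N x -> N (- x).
Proof. by move=> SN Nx; rewrite -scaleN1r; apply: submodZ. Qed.

Lemma submodB M (N : set M) x y : submodule N -> N x -> N y -> N (x - y).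
Proof. by move=> SN Nx Ny; apply: submodD => //; apply: submodN. Qed.

Lemma submodI M (N N' : set M) :
  submodule N -> submodule N' -> submodule (N `&` N').
Proof. by move=> [? ?] [? ?]; split=> // a x y [? ?] [? ?]; split; auto. Qed.

Lemma submodT M : submodule [set: M]. Proof. by []. Qed.

Lemma submod0 M : submodule [set 0 : M].
Proof. by split=> // a x y -> ->; rewrite scaler0 addr0. Qed.

Definition sumsub M (N N' : set M) : set M :=
  [set z | exists x y, [/\ N x, N' y & z = x + y]].

Lemma submod_sum M (N N' : set M) :
  submodule N -> submodule N' -> submodule (sumsub N N').
Proof.
move=> [N0 NL] [N0' NL']; split; first by exists 0, 0; rewrite addr0.
move=> a _ _ [x [y [Nx Ny ->]]] [x' [y' [Nx' Ny' ->]]].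
exists (a *: x + x'), (a *: y + y'); split; auto.
by rewrite scalerDr addrACA.
Qed.

Lemma subset_sumsubl M (N N' : set M) : submodule N' -> N `<=` sumsub N N'.
Proof. by move=> [N0 _] x Nx; exists x, 0; rewrite addr0. Qed.

Lemma subset_sumsubr M (N N' : set M) : submodule N -> N' `<=` sumsub N N'.
Proof. by move=> [N0 _] x Nx; exists 0, x; rewrite add0r. Qed.

Lemma sumsub_min M (N N' L : set M) : submodule L ->
  N `<=` L -> N' `<=` L -> sumsub N N' `<=` L.
Proof.
by move=> SL NL NL' _ [x [y [/NL ? /NL' ? ->]]]; apply: submodD.
Qed.

Definition linear_on M A (N : set M) (h : M -> A) : Prop :=
  forall a x y, N x -> N y -> h (a *: x + y) = a *: h x + h y.

Lemma linear_on0 M A (N : set M) (h : M -> A) :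
  submodule N -> linear_on N h -> h 0 = 0.
Proof.
move=> [N0 _] hL; have := hL 1 0 0 N0 N0.
by rewrite !scale1r addr0 => /eqP; rewrite -subr_eq0 opprD addNKr oppr_eq0 => /eqP.
Qed.

Lemma linear_onB M A (N : set M) (h : M -> A) x y :
  linear_on N h -> N x -> N y -> h (x - y) = h x - h y.
Proof.
by move=> hL Nx Ny; have := hL (-1) y x Ny Nx; rewrite !scaleN1r ![- _ + _]addrC.
Qed.

Lemma linear_onZ M A (N : set M) (h : M -> A) a x :
  submodule N -> linear_on N h -> N x -> h (a *: x) = a *: h x.
Proof.
move=> SN hL Nx; have := hL a x 0 Nx SN.1.
by rewrite (linear_on0 SN hL) !addr0.
Qed.

(** Lifting a map f along a map g means selecting, linearly in x, a solution
    u of the linear relation g u = f x. Sections, retractions and liftings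
    defined on a submodule only have the same form, so that projectivity can
    be handled for subsets, without types for submodules and quotients. *)
Definition linear_rel M A (G : M -> A -> Prop) : Prop :=
  forall a x y u v, G x u -> G y v -> G (a *: x + y) (a *: u + v).

Definition selects M A (N : set M) (G : M -> A -> Prop) (h : M -> A) : Prop :=
  linear_on N h /\ forall x, N x -> G x (h x).

Definition projOn M (N : set M) : Prop :=
  forall A (G : M -> A -> Prop), linear_rel G ->
    (forall x, N x -> exists u, G x u) -> exists h, selects N G h.

Lemma projOn_retract M M' (N : set M) (N' : set M')
    (i : M -> M') (r : M' -> M) :
  submodule N' -> linear_on N i -> linear_on N' r ->
  (forall x, N x -> N' (i x)) -> (forall y, N' y -> N (r y)) ->
  (forall x, N x -> r (i x) = x) -> projOn N' -> projOn N.
Proof.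
move=> SN' iL rL Ni Nr ri PN' A G GL Gt.
have [] := PN' A (fun y u => N' y /\ G (r y) u).
- move=> a x y u v [Nx Gx] [Ny Gy]; split; first exact: SN'.2.
  by rewrite rL //; apply: GL.
- by move=> y Ny; have [u Gu] := Gt _ (Nr _ Ny); exists u.
move=> h [hL hG]; exists (h \o i); split.
  by move=> a x y Nx Ny /=; rewrite iL // hL; auto.
by move=> x Nx /=; have [_] := hG _ (Ni _ Nx); rewrite ri.
Qed.

(** If the quotient N2 of N is projective then N splits as the kernel plus a
    copy of N2; the selection is assembled from the two pieces. *)
Lemma projOn_ext M M' (N : set M) (N2 : set M') (k : M -> M') :
  submodule N -> submodule N2 -> linear_on N k ->
  (forall x, N x -> N2 (k x)) -> (forall y, N2 y -> exists2 x, N x & k x = y) ->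
  projOn N2 -> projOn [set x | N x /\ k x = 0] -> projOn N.
Proof.
move=> SN SN2 kL Nk kN P2 P1.
have [] := P2 M (fun y x => N x /\ k x = y).
- by move=> a x y u v [Nx <-] [Ny <-]; split; [exact: SN.2 | exact: kL].
- by move=> y /kN [x]; exists x.
move=> s [sL sN] A G GL Gt.
have [|h1 [h1L h1G]] := P1 A G GL; first by move=> x [/Gt].
have [] := P2 A (fun y u => N2 y /\ G (s y) u).
- move=> a x y u v [Nx Gx] [Ny Gy]; split; first exact: SN2.2.
  by rewrite sL //; apply: GL.
- by move=> y Ny; have [Ns _] := sN _ Ny; have [u Gu] := Gt _ Ns; exists u.
move=> h2 [h2L h2G].
have kerP x : N x -> N (x - s (k x)) /\ k (x - s (k x)) = 0.
  move=> Nx; have [Ns ks] := sN _ (Nk _ Nx).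
  by split; [exact: submodB | rewrite (linear_onB kL) // ks subrr].
exists (fun x => h1 (x - s (k x)) + h2 (k x)); split.
  move=> a x y Nx Ny; rewrite kL // sL ?h2L; auto.
  have -> : a *: x + y - (a *: s (k x) + s (k y)) =
            a *: (x - s (k x)) + (y - s (k y)).
    by rewrite scalerBr opprD addrACA.
  by rewrite h1L ?scalerDr 1?addrACA //; apply: kerP.
move=> x Nx; have [_ G2] := h2G _ (Nk _ Nx).
by have := GL 1 _ _ _ _ (h1G _ (kerP _ Nx)) G2; rewrite !scale1r subrK.
Qed.

Lemma projOn0 M : projOn [set 0 : M].
Proof.
move=> A G GL Gt; have [u Gu] := Gt 0 erefl.
exists (fun=> 0); split=> [a x y _ _|x ->]; first by rewrite scaler0 addr0.
by have := GL (-1) _ _ _ _ Gu Gu; rewrite !scaleN1r !addNr.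
Qed.

Lemma projOn_ring : projOn [set: R^o].
Proof.
move=> A G GL Gt; have [u Gu] := Gt 1 I; have [v Gv] := Gt 0 I.
exists (fun r : R^o => r *: u); split=> [a x y _ _|x _].
  by rewrite scalerDl scalerA.
have G0 : G 0 0 by have := GL (-1) _ _ _ _ Gv Gv; rewrite !scaleN1r !addNr.
by have := GL x _ _ _ _ Gu G0; rewrite !addr0 -[x *: 1]/(x * 1) mulr1.
Qed.

Lemma projOn_inj_image M M' (N : set M) (k : M -> M') :
  submodule N -> linear_on N k -> (forall x, N x -> k x = 0 -> x = 0) ->
  projOn N <-> projOn (k @` N).
Proof.
move=> SN kL kI.
have kinj x y : N x -> N y -> k x = k y -> x = y.
  move=> Nx Ny e; apply/eqP; rewrite -subr_eq0; apply/eqP/kI.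
    exact: submodB.
  by rewrite (linear_onB kL) // e subrr.
have SkN : submodule (k @` N).
  split; first by exists 0; [exact: SN.1 | exact: linear_on0 SN kL].
  move=> a _ _ [x Nx <-] [y Ny <-]; exists (a *: x + y); first exact: SN.2.
  exact: kL.
pose j z := xget 0 [set x | N x /\ k x = z].
have jP z : (k @` N) z -> N (j z) /\ k (j z) = z.
  by move=> [x Nx e]; apply: (xgetPex 0 (P := [set x | N x /\ k x = z])); exists x.
have jL : linear_on (k @` N) j.
  move=> a x y kx ky; have [Nx ex] := jP _ kx; have [Ny ey] := jP _ ky.
  have [Nxy exy] := jP _ (SkN.2 a _ _ kx ky).
  by apply: kinj; rewrite ?exy ?kL ?ex ?ey //; apply: SN.2.
have kN x : N x -> (k @` N) (k x) by move=> Nx; exists x.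
split.
  apply: (projOn_retract (i := j) (r := k)) => // z /jP[] //.
apply: (projOn_retract (i := k) (r := j)) => //; first by move=> y /jP[].
by move=> x Nx; have [Nj e] := jP _ (kN _ Nx); apply: kinj.
Qed.

(** The sequence 0 -> N n N' -> N (+) N' -> N + N' -> 0 has projective ends,
    so its middle term and the summand N of it are projective. *)
Lemma projOn_sum_cap M (N N' : set M) : submodule N -> submodule N' ->
  projOn (sumsub N N') -> projOn (N `&` N') -> projOn N.
Proof.
move=> SN SN' Ps Pc.
pose P : set (M * M)%type := [set z | N z.1 /\ N' z.2].
have SP : submodule P.
  split; first by split; [exact: SN.1 | exact: SN'.1].
  move=> a x y [x1 x2] [y1 y2]; split; [exact: SN.2 | exact: SN'.2].
have PP : projOn P.
  apply: (projOn_ext (k := fun z => z.1 + z.2) SP (submod_sum SN SN')) => //.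
  - by move=> a x y _ _ /=; rewrite scalerDr addrACA.
  - by move=> x [x1 x2]; exists x.1, x.2.
  - by move=> _ [x [y [Nx Ny ->]]]; exists (x, y).
  apply: (projOn_retract (N' := N `&` N') (i := fst) (r := fun x => (x, - x))) => //.
  - exact: submodI.
  - by move=> a x y _ _; rewrite opprD -scalerN.
  - move=> x [[x1 x2] /= /eqP]; rewrite addr_eq0 => /eqP e; split=> //=.
    by rewrite e; apply: submodN.
  - move=> x [Nx Nx']; rewrite /= subrr; split=> //; split=> //=.
    exact: submodN.
  - by move=> [x1 x2] [_ /= /eqP]; rewrite addrC addr_eq0 => /eqP ->.
apply: (projOn_retract (N' := P) (i := fun x => (x, 0)) (r := fst)) PP => //.
- by move=> a x y _ _; congr (_, _); rewrite /= scaler0 addr0.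
- by move=> x Nx; split=> //; apply: SN'.1.
- by move=> x [].
Qed.

End Submodules.

(** * Extension of selections by Zorn's lemma *)

Section Extension.
Variable R : nzRingType.
Implicit Types M A : lmodType R.

Lemma selects_sum M A (N P : set M) (G : M -> A -> Prop) (h k : M -> A) :
  submodule N -> submodule P -> (forall x, N x -> P x -> x = 0) ->
  linear_rel G -> selects N G h -> selects P G k ->
  exists2 f, selects (sumsub N P) G f & forall x, N x -> f x = h x.
Proof.
move=> SN SP NP0 GL [hL hG] [kL kG].
pose f z := xget 0 [set u | exists x y, [/\ N x, P y, z = x + y & u = h x + k y]].
have fE x y : N x -> P y -> f (x + y) = h x + k y.
  move=> Nx Py; rewrite /f; case: xgetP => [u _ [x' [y' [Nx' Py' e ->]]]|].
    have d : x - x' = y' - y.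
      by apply/eqP; rewrite subr_eq addrAC eq_sym subr_eq eq_sym addrC -e addrC.
    have e0 : x - x' = 0 by apply: NP0; [|rewrite d]; apply: submodB.
    move/eqP: (e0); rewrite subr_eq0 => /eqP <-.
    by move: e0; rewrite d => /eqP; rewrite subr_eq0 => /eqP <-.
  by move=> /(_ (h x + k y)) []; exists x, y.
exists f; last first.
  by move=> x Nx; rewrite -[x in f x]addr0 fE ?(linear_on0 SP kL) ?addr0 //; case: SP.
split.
  move=> a _ _ [x [y [Nx Py ->]]] [x' [y' [Nx' Py' ->]]].
  rewrite scalerDr addrACA !fE //; [|exact: SN.2|exact: SP.2].
  by rewrite hL // kL // scalerDr addrACA.
move=> _ [x [y [Nx Py ->]]]; rewrite fE //.
by have := GL 1 _ _ _ _ (hG _ Nx) (kG _ Py); rewrite !scale1r.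
Qed.

(** Transfinite construction of a selection. The family [SS] of intermediate
    submodules is left free, because two different ones are needed: all
    submodules, for semisimple modules, and the submodules of the elements
    with prescribed support, for submodules of free modules. In each step a
    projective direct summand is added, on which a selection exists. *)
Lemma selection_extension M A (SS : set (set M)) (N N0 : set M)
    (G : M -> A -> Prop) (h0 : M -> A) :
  (forall N', SS N' -> submodule N' /\ N' `<=` N) ->
  (forall C : set (set M), C !=set0 -> C `<=` SS -> total_on C subset ->
     SS (\bigcup_(X in C) X)) ->
  (forall N', SS N' -> N0 `<=` N' -> N' <> N -> exists P, [/\ submodule P,
     projOn P, forall x, N' x -> P x -> x = 0, SS (sumsub N' P)
     & ~ P `<=` N']) ->
  SS N0 -> linear_rel G -> (forall x, N x -> exists u, G x u) ->
  selects N0 G h0 ->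
  exists2 h, selects N G h & forall x, N0 x -> h x = h0 x.
Proof.
move=> SSN SSC step SS0 GL Gt sel0.
pose ok (z : set M * (M -> A)) := [/\ SS z.1, N0 `<=` z.1, selects z.1 G z.2 &
  forall x, N0 x -> z.2 x = h0 x].
pose T := {z | ok z}.
(* Functions that agree on a submodule need not agree outside it, so
   extension is only a preorder. *)
pose le (s t : T) := `[< (sval s).1 `<=` (sval t).1 /\
  forall x, (sval s).1 x -> (sval t).2 x = (sval s).2 x >].
have ok0 : ok (N0, h0) by split.
have [||C totC|[[N' h] okt] maxh] :=
    @ZL_preorder T (exist _ _ ok0) le.
- by move=> t; apply/asboolP; split.
- move=> r s t /asboolP [rs ers] /asboolP [st est]; apply/asboolP.
  by split=> [x /rs /st //|x rx]; rewrite est ?ers //; apply: rs.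
- have [C0|/set0P [c0 Cc0]] := eqVneq C set0.
    by exists (exist _ _ ok0) => s; rewrite C0.
  pose U := \bigcup_(X in [set (sval c).1 | c in C]) X.
  have UP x : U x -> exists2 c, C c & (sval c).1 x.
    by move=> [_ [c Cc <-] cx]; exists c.
  pose f x := xget 0 [set u | exists c, [/\ C c, (sval c).1 x & u = (sval c).2 x]].
  have fE c x : C c -> (sval c).1 x -> f x = (sval c).2 x.
    move=> Cc cx; rewrite /f; case: xgetP => [u _ [c' [Cc' c'x ->]]|].
      by have [/asboolP[_ ->]|/asboolP[_ ->]] := totC _ _ Cc Cc'.
    by move=> /(_ ((sval c).2 x)) []; exists c.
  have common x y : U x -> U y -> exists c, [/\ C c, (sval c).1 x & (sval c).1 y].
    move=> /UP [c Cc cx] /UP [d Cd dy].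
    have [/asboolP [cd _]|/asboolP [dc _]] := totC _ _ Cc Cd.
      by exists d; split=> //; apply: cd.
    by exists c; split=> //; apply: dc.
  have okU : ok (U, f).
    split=> /=.
    + apply: SSC; first by exists (sval c0).1, c0.
        by move=> _ [c _ <-]; case: (svalP c).
      move=> _ _ [c Cc <-] [d Cd <-].
      by have [/asboolP[]|/asboolP[]] := totC _ _ Cc Cd; [left|right].
    + move=> x N0x; exists (sval c0).1; first by exists c0.
      by case: (svalP c0) => _ + _ _; apply.
    + split.
        move=> a x y Ux Uy; have [c [Cc cx cy]] := common _ _ Ux Uy.
        have [Sc _ [cL _] _] := svalP c; have [Lc _] := SSN _ Sc.
        by rewrite !(fE c) ?cL //; apply: Lc.2.
      move=> x /UP [c Cc cx]; rewrite (fE c) //.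
      by have [_ _ [_ +] _] := svalP c; apply.
    + move=> x N0x; have [_ sub _ e] := svalP c0.
      by rewrite (fE c0) ?e //; apply: sub.
  exists (exist _ _ okU) => c Cc; apply/asboolP => /=; split.
    by move=> x cx; exists (sval c).1; first by exists c.
  by move=> x cx; apply: fE.
have [/= SS' N0' sel' h'0] := okt; have [SN' N'N] := SSN _ SS'.
have [eN|/(step _ SS' N0') [P [SP PP NP0 SSP nP]]] := pselect (N' = N).
  by rewrite -eN; exists h.
have [k selk] : exists k, selects P G k.
  apply: PP => // x Px; apply: Gt; have [_ sub] := SSN _ SSP.
  exact/sub/(subset_sumsubr SN').
have [f self ef] := selects_sum SN' SP NP0 GL sel' selk.
have okf : ok (sumsub N' P, f).
  split=> //= [x /N0' N'x|x N0x]; first exact: subset_sumsubl.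
  by rewrite ef ?h'0 //; apply/N0'.
case: nP; have /asboolP[/= sub _] : le (exist _ _ okf) (exist _ _ okt).
  by apply: maxh; apply/asboolP; split=> //=; apply: subset_sumsubl.
by move=> x Px; apply/sub/(subset_sumsubr SN').
Qed.

End Extension.

(** * Submodules, quotients and free modules as types *)

Section SubQuotient.
Variables (R : nzRingType) (M : lmodType R) (N : set M) (SN : submodule N).

(** The proof argument is a key: it lets the closure properties be inferred
    from the predicate. *)
Definition sub_pred (_ : submodule N) : {pred M} := fun x => `[< N x >].

Fact sub_pred_closed : submod_closed (sub_pred SN).
Proof.
split; first exact/asboolP/SN.1.
by move=> a x y /asboolP Nx /asboolP Ny; apply/asboolP/SN.2.
Qed.
HB.instance Definition _ :=
  GRing.isSubmodClosed.Build R M (sub_pred SN) sub_pred_closed.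

Record submod_type := SubmodType {
  submod_val : M;
  _ : submod_val \in sub_pred SN }.

HB.instance Definition _ := [isSub for submod_val].
HB.instance Definition _ := [Choice of submod_type by <:].
HB.instance Definition _ := [SubChoice_isSubLmodule of submod_type by <:].

Lemma submod_valP (u : submod_type) : N (val u).
Proof. by case: u => x /= /asboolP. Qed.

Definition quotmod_type : Type := Quotient.quot (sub_pred SN).
HB.instance Definition _ := GRing.Zmodule.on quotmod_type.

Definition quot_proj (x : M) : quotmod_type :=
  \pi_(Quotient.quot (sub_pred SN)) x.

Lemma quot_projP x y : quot_proj x = quot_proj y <-> N (x - y).
Proof.
have e : (x - y \in sub_pred SN) = (x == y %[mod Quotient.quot (sub_pred SN)]).
  exact: Quotient.idealrBE.
split; first by move=> /eqP; rewrite /quot_proj -e => /asboolP.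
by move=> /asboolP; rewrite -[asbool _]/(x - y \in sub_pred SN) e => /eqP.
Qed.

Lemma quot_projD x y : quot_proj (x + y) = quot_proj x + quot_proj y.
Proof. exact: Quotient.pi_add. Qed.

Lemma quot_proj_surj u : exists x, quot_proj x = u.
Proof. by exists (repr (u : Quotient.quot (sub_pred SN))); apply: reprK. Qed.

Definition quot_scale (a : R) (u : quotmod_type) : quotmod_type :=
  quot_proj (a *: repr (u : Quotient.quot (sub_pred SN))).

Lemma quot_projZ a x : quot_proj (a *: x) = quot_scale a (quot_proj x).
Proof.
apply/quot_projP; rewrite -scalerBr; apply: submodZ => //.
by apply/quot_projP; rewrite /quot_proj reprK.
Qed.

Fact quot_scaleA a b u : quot_scale a (quot_scale b u) = quot_scale (a * b) u.
Proof. by have [x <-] := quot_proj_surj u; rewrite -!quot_projZ scalerA. Qed.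
Fact quot_scale1 : left_id 1 quot_scale.
Proof. by move=> u; have [x <-] := quot_proj_surj u; rewrite -quot_projZ scale1r. Qed.
Fact quot_scaleDr : right_distributive quot_scale +%R.
Proof.
move=> a u v; have [x <-] := quot_proj_surj u; have [y <-] := quot_proj_surj v.
by rewrite -quot_projD -!quot_projZ -quot_projD scalerDr.
Qed.
Fact quot_scaleDl u : {morph quot_scale^~ u : a b / a + b}.
Proof.
move=> a b; have [x <-] := quot_proj_surj u.
by rewrite -!quot_projZ -quot_projD scalerDl.
Qed.
HB.instance Definition _ := GRing.Zmodule_isLmodule.Build R quotmod_type
  quot_scaleA quot_scale1 quot_scaleDr quot_scaleDl.

Fact quot_proj_linear : linear quot_proj.
Proof. by move=> a x y; rewrite quot_projD quot_projZ. Qed.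
HB.instance Definition _ :=
  GRing.isLinear.Build R M quotmod_type _ quot_proj quot_proj_linear.

End SubQuotient.

Section Bundling.
Variable R : nzRingType.
Implicit Types A B M : lmodType R.

Lemma linear_bundle A B (f : A -> B) : linear f ->
  exists h : {linear A -> B}, forall x, h x = f x.
Proof.
move=> fL; pose m := GRing.isLinear.Build R A B _ f fL.
by exists (HB.pack_for {linear A -> B} f m).
Qed.

Lemma projOn_projective M (N : set M) (SN : submodule N) :
  projOn N -> projective (submod_type SN).
Proof.
move=> PN A B g f gs.
have [] := PN A (fun x a => exists2 x' : submod_type SN, val x' = x & g a = f x').
- move=> a x y u v [x' <- ex] [y' <- ey]; exists (a *: x' + y').
    by rewrite linearP.
  by rewrite !linearP ex ey.
- move=> x /asboolP Nx; pose x' : submod_type SN := SubmodType Nx.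
  by have [a e] := gs (f x'); exists a, x'.
move=> h [hL hG]; have [|k kE] := @linear_bundle _ _ (fun x : submod_type SN => h (val x)).
  by move=> a x y; rewrite linearP hL //; apply: submod_valP.
exists k => x; rewrite kE; have [|x' /val_inj -> //] := hG (val x).
exact: submod_valP.
Qed.

End Bundling.

Section FreeModule.
Variables (R : nzRingType) (I : eqType).

Definition finsupp_pred : {pred I -> R^o} := fun f =>
  `[< exists s : seq I, forall i, f i != 0 -> i \in s >].

Fact finsupp_pred_closed : submod_closed finsupp_pred.
Proof.
split; first by apply/asboolP; exists [::] => i; rewrite eqxx.
move=> a f g /asboolP [s fs] /asboolP [t gt]; apply/asboolP.
exists (s ++ t) => i; rewrite mem_cat => fg0.
have [f0|/fs -> //] := eqVneq (f i) 0; rewrite gt ?orbT //.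
apply: contraNneq fg0 => g0.
by rewrite -[X in X == 0]/(a * f i + g i) f0 g0 addr0 mulr0.
Qed.
HB.instance Definition _ :=
  GRing.isSubmodClosed.Build R (I -> R^o) finsupp_pred finsupp_pred_closed.

Record freemod := FreeMod { fcoord : I -> R^o; _ : fcoord \in finsupp_pred }.
HB.instance Definition _ := [isSub for fcoord].
HB.instance Definition _ := [Choice of freemod by <:].
HB.instance Definition _ := [SubChoice_isSubLmodule of freemod by <:].

Lemma fcoordD (x y : freemod) i : fcoord (x + y) i = fcoord x i + fcoord y i.
Proof. by []. Qed.

Lemma fcoordZ a (x : freemod) i : fcoord (a *: x) i = a * fcoord x i.
Proof. by []. Qed.

Lemma fcoord_finite (x : freemod) :
  exists s : seq I, forall i, fcoord x i != 0 -> i \in s.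
Proof. by case: x => f /= /asboolP. Qed.

End FreeModule.

(** * Submodules of free modules over left hereditary rings *)

Definition left_hereditary (R : nzRingType) : Prop :=
  forall L : set R^o, submodule L -> projOn L.

Section Kaplansky.
Variables (R : nzRingType) (I : eqType).
Local Notation P := (freemod R I).
Hypothesis herR : left_hereditary R.

Definition supported (N : set P) (J : set I) : set P :=
  [set x | N x /\ forall i, fcoord x i != 0 -> J i].

Lemma submod_supported N J : submodule N -> submodule (supported N J).
Proof.
move=> [N0 NL]; split; first by split=> // i; rewrite eqxx.
move=> a x y [Nx Jx] [Ny Jy]; split; first exact: NL.
move=> i; rewrite fcoordD fcoordZ.
have [x0|/Jx //] := eqVneq (fcoord x i) 0; have [y0|/Jy //] := eqVneq (fcoord y i) 0.
by rewrite x0 y0 mulr0 addr0 eqxx.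
Qed.

(** Kaplansky's theorem, in the form needed here. Adding one index i to the
    support J enlarges the part of N supported in J by a summand isomorphic to
    the left ideal of the i-th coordinates. *)
Lemma projOn_submod_free (N : set P) : submodule N -> projOn N.
Proof.
move=> SN A G GL Gt.
pose SS N' := exists J, N' = supported N J.
have [|||||h selh _] := @selection_extension _ _ _ SS N [set 0] G (fun=> 0)
    _ _ _ _ GL Gt; last by exists h.
- by move=> _ [J ->]; split; [exact: submod_supported | move=> x []].
- move=> C [C0 CC0] CS totC.
  exists [set i | exists X x, [/\ C X, X x & fcoord x i != 0]].
  rewrite eqEsubset; split=> x.
    move=> [X CX Xx]; split; last by move=> i xi; exists X, x.
    by have [J eX] := CS _ CX; move: Xx; rewrite eX => -[].
  move=> [Nx Jx]; have [s sx] := fcoord_finite x.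
  have [X CX Xs] : exists2 X, C X & forall i, i \in s -> fcoord x i != 0 ->
      exists2 y, X y & fcoord y i != 0.
    elim: s {sx} => [|j s [X CX Xs]]; first by exists C0.
    have [xj0|/Jx [Y [y [CY Yy yj]]]] := eqVneq (fcoord x j) 0.
      exists X => // i; rewrite inE => /orP[/eqP ->|]; last exact: Xs.
      by rewrite xj0 eqxx.
    have [XY|YX] := totC _ _ CX CY.
      exists Y => // i; rewrite inE => /orP[/eqP ->|/Xs + /[dup] + xi]; first by exists y.
      by move=> /[apply] -[z /XY Yz zi]; exists z.
    exists X => // i; rewrite inE => /orP[/eqP ->|]; last exact: Xs.
    by exists y => //; apply: YX.
  exists X => //; have [J eX] := CS _ CX; rewrite eX; split=> // i xi.
  have [y + yi] := Xs _ (sx _ xi) xi; rewrite eX => -[_]; exact.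
- move=> _ [J ->] _ neN.
  (* A single new index may add nothing, so the element x below is chosen with
     as few indices outside J as possible; all of them but i add nothing. *)
  have [x Nx nJx] : exists2 x, N x & ~ supported N J x.
    apply: contrapT => none; apply: neN; rewrite eqEsubset.
    split=> [x []//|x Nx]; apply: contrapT => nJx; apply: none; by exists x.
  pose Q n := `[< exists x (s : seq I), [/\ N x, ~ supported N J x, size s = n &
    forall i, fcoord x i != 0 -> J i \/ i \in s] >].
  have exQ : exists n, Q n.
    have [s sx] := fcoord_finite x; exists (size s); apply/asboolP.
    by exists x, s; split=> // i /sx; right.
  case: (ex_minnP exQ) => -[|n] /asboolP[{}x [s [{}Nx {}nJx sz sx]]] minn.
    move/size0nil: sz => s0; case: nJx; split=> // i /sx [//|].
    by rewrite s0.
  case: s => [//|i s] /= in sz sx; case: sz => sz.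
  pose J1 := J `|` [set j | j \in s]; pose J2 := J1 `|` [set i].
  have eJ1 : supported N J = supported N J1.
    rewrite eqEsubset; split=> y [Ny Jy]; first by split=> // j /Jy; left.
    apply: contrapT => nJy; have : Q n.
      by apply/asboolP; exists y, s; split=> // j /Jy.
    by move=> /minn; rewrite ltnn.
  have SJ2 := submod_supported J2 SN.
  pose L : set R^o := [set fcoord y i | y in supported N J2].
  have SL : submodule L.
    split; first by exists 0 => //; apply: SJ2.1.
    move=> a _ _ [y Jy <-] [z Jz <-]; exists (a *: y + z) => //.
    exact: SJ2.2.
  have [] := herR SL (G := fun l y => supported N J2 y /\ fcoord y i = l).
  - by move=> a l m y z [Jy <-] [Jz <-]; split=> //; apply: SJ2.2.
  - by move=> l [y Jy <-]; exists y.
  move=> sg [sgL sgP].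
  have sgI l : L l -> sg l = 0 -> l = 0.
    by move=> Ll e; have [_ <-] := sgP _ Ll; rewrite e.
  have Jx : supported N J2 x.
    split=> // j /sx [Jj|]; first by left; left.
    by rewrite inE => /orP[/eqP ->|js]; [right | left; right].
  have eq2 : sumsub (supported N J) (sg @` L) = supported N J2.
    rewrite eJ1 eqEsubset; split.
      apply: sumsub_min => // [y [Ny Jy]|_ [l Ll <-]]; last by case: (sgP _ Ll).
      by split=> // j /Jy; left.
    move=> y Jy; have Ll : L (fcoord y i) by exists y.
    have [Js ei] := sgP _ Ll.
    exists (y - sg (fcoord y i)), (sg (fcoord y i)); rewrite subrK.
    split=> //.
    have [Nd Jd] : supported N J2 (y - sg (fcoord y i)) by apply: submodB.
    split=> // j /[dup] dj /Jd [//|/= ej].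
    by move: dj; rewrite ej fcoordD -scaleN1r fcoordZ mulN1r ei subrr eqxx.
  exists (sg @` L); split.
  + split; first by exists 0; [exact: SL.1 | exact: linear_on0 SL sgL].
    move=> a _ _ [l Ll <-] [m Lm <-]; exists (a *: l + m); first exact: SL.2.
    exact: sgL.
  + by apply/(projOn_inj_image SL sgL sgI); apply: herR.
  + move=> y [Ny Jy] [l Ll ey].
    have [si|/Jy] := eqVneq (fcoord y i) 0.
      rewrite -ey; suff -> : l = 0 by exact: linear_on0 SL sgL.
      by have [_ <-] := sgP _ Ll; rewrite ey.
    move=> Ji; case: nJx; rewrite eJ1; split=> // k /sx [Jk|]; first by left.
    by rewrite inE => /orP[/eqP ->|]; [left | right].
  + by exists J2.
  + move=> sub; apply: nJx.
    suff : supported N J2 `<=` supported N J by apply.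
    rewrite -eq2; apply: sumsub_min => //; exact: submod_supported.
- rewrite /SS; exists set0; rewrite eqEsubset; split=> x.
    by move=> ->; split=> [|i]; [exact: SN.1 | rewrite eqxx].
  move=> [_ x0]; apply: val_inj; apply: funext => i; apply/eqP.
  by apply: contrapT => /negP /x0.
- have [u Gu] := Gt _ SN.1; split=> [a x y _ _|x ->].
    by rewrite scaler0 addr0.
  by have := GL (-1) _ _ _ _ Gu Gu; rewrite !scaleN1r !addNr.
Qed.

End Kaplansky.

Section Cover.
Variables (R : nzRingType) (M : lmodType R).
Implicit Types x y : freemod R M.

Definition csum (s : seq M) x : M := \sum_(m <- s) fcoord x m *: m.

(** A linear combination with coefficients x may be summed over any
    duplicate-free list that contains the support, see [csum_indep]; two
    elements have a common such list. *)
Definition covers (s : seq M) x : Prop :=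
  uniq s /\ forall m, fcoord x m != 0 -> m \in s.

Lemma csum_filter s x : csum s x = csum [seq m <- s | fcoord x m != 0] x.
Proof.
rewrite /csum big_filter [in RHS]big_mkcond /=; apply: eq_bigr => m _.
by case: eqVneq => // ->; rewrite scale0r.
Qed.

Lemma csum_indep s t x : covers s x -> covers t x -> csum s x = csum t x.
Proof.
move=> [us sx] [ut tx]; rewrite csum_filter [RHS]csum_filter; apply: perm_big.
apply: uniq_perm; rewrite ?filter_uniq // => m; rewrite !mem_filter.
by case: (boolP (_ != 0)) => //= xm; rewrite sx // tx.
Qed.

Lemma covers_exist x y : exists s, covers s x /\ covers s y.
Proof.
have [s sx] := fcoord_finite x; have [t ty] := fcoord_finite y.
exists (undup (s ++ t)); split; split; rewrite ?undup_uniq // => m.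
  by move=> /sx; rewrite mem_undup mem_cat => ->.
by move=> /ty; rewrite mem_undup mem_cat orbC => ->.
Qed.

Definition cover_fun x : M := csum (xget [::] [set s | covers s x]) x.

Lemma cover_funE s x : covers s x -> cover_fun x = csum s x.
Proof.
move=> sx; apply: csum_indep => //.
by apply: (xgetPex [::] (P := [set s | covers s x])); exists s.
Qed.

Fact cover_linear : linear cover_fun.
Proof.
move=> a x y; have [s [sx sy]] := covers_exist x y.
have sxy : covers s (a *: x + y).
  split; first by case: sx.
  move=> m; rewrite fcoordD fcoordZ.
  have [x0|/sx.2 //] := eqVneq (fcoord x m) 0; have [y0|/sy.2 //] := eqVneq (fcoord y m) 0.
  by rewrite x0 y0 mulr0 addr0 eqxx.
rewrite !(@cover_funE s) // /csum scaler_sumr -big_split /=.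
apply: eq_bigr => m _.
by rewrite -[(_ + _) m]/(a * fcoord x m + fcoord y m) scalerDl scalerA.
Qed.
HB.instance Definition _ :=
  GRing.isLinear.Build R (freemod R M) M _ cover_fun cover_linear.

Lemma cover_surj m : exists x, cover_fun x = m.
Proof.
pose f (n : M) : R^o := (n == m)%:R.
have fP : f \in @finsupp_pred R M.
  apply/asboolP; exists [:: m] => n; rewrite inE /f.
  by case: (n == m) => //=; rewrite eqxx.
exists (FreeMod fP); rewrite (@cover_funE [:: m]).
  by rewrite /csum big_seq1 /= /f eqxx scale1r.
split=> // n /=; rewrite inE /f.
by case: (n == m) => //=; rewrite eqxx.
Qed.

End Cover.

(** * Global dimension one *)

Lemma least_eq (P : nat -> Prop) n :
  P n -> (forall m, (m < n)%N -> ~ P m) -> least P = Some n.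
Proof.
move=> Pn min; rewrite /least; case: pselect => [exP|]; last first.
  by case; exists n; apply/asboolP.
case: ex_minnP => m /asboolP Pm le_m; congr Some; apply/eqP.
rewrite eqn_leq le_m ?andTb; last exact/asboolP.
by rewrite leqNgt; apply/negP => /min /(_ Pm).
Qed.

Lemma least_le (P : nat -> Prop) n :
  P n -> exists2 m, least P = Some m & (m <= n)%N.
Proof.
move=> Pn; rewrite /least; case: pselect => [exP|]; last first.
  by case; exists n; apply/asboolP.
by case: ex_minnP => m _ le_m; exists m => //; apply/le_m/asboolP.
Qed.

Lemma leastP (P : nat -> Prop) n : least P = Some n -> P n.
Proof.
rewrite /least; case: pselect => // exP [].
by case: ex_minnP => m /asboolP Pm _ <-.
Qed.

Section UpperBound.
Variables (R : nzRingType) (M : lmodType R).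
Hypothesis herR : left_hereditary R.

Local Notation P0 := (freemod R M).
Local Notation aug := (@cover_fun R M).

Fact submod_kernel : submodule [set x : P0 | aug x = 0].
Proof.
split; first exact: linear0.
by move=> a x y /= ex ey; rewrite cover_linear ex ey scaler0 addr0.
Qed.

Let res_mod i : lmodType R :=
  match i with
  | 0 => P0
  | 1 => submod_type submod_kernel
  | _ => submod_type (submod0 P0)
  end.

Let res_d i : {linear res_mod i.+1 -> res_mod i} :=
  match i return {linear res_mod i.+1 -> res_mod i} with
  | 0 => (val : submod_type submod_kernel -> P0)
  | _ => \0
  end.

Lemma submod_zeroP (x : submod_type (submod0 P0)) : x = 0.
Proof. by apply: val_inj; rewrite linear0; apply: submod_valP x. Qed.

(** The resolution is the free cover of M followed by its kernel. *)
Lemma pdim_le1 : pdim_le M 1.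
Proof.
have proj i : projective (res_mod i).
  case: i => [|[|i]] /=.
  - move=> A B g f gs; have [] := projOn_submod_free herR (submodT P0)
      (G := fun x a => g a = f x).
    + by move=> a x y u v ex ey; rewrite !linearP ex ey.
    + by move=> x _; apply: gs.
    move=> h [hL hG]; have [|k kE] := @linear_bundle _ _ _ h.
      by move=> a x y; apply: hL.
    by exists k => x; rewrite kE; apply: hG.
  - exact/projOn_projective/projOn_submod_free/submod_kernel.
  - exact/projOn_projective/projOn0.
have ex0 (x : res_mod 0) : aug x = 0 <-> exists y, res_d 0 y = x.
  split=> [e|[y <-]]; last exact: submod_valP y.
  have xK : x \in sub_pred submod_kernel by apply/asboolP.
  by exists (SubmodType xK).
have ex1 i (x : res_mod i.+1) : res_d i x = 0 <-> exists y, res_d i.+1 y = x.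
  case: i x => [|i] x /=.
    split=> [e|[y <-]]; last by [].
    by exists 0; apply: val_inj; rewrite /= e.
  by split=> _ //; exists 0; rewrite [RHS]submod_zeroP.
exists (ProjResolution proj (@cover_surj R M) ex0 ex1).
by case=> [|[|i]] //= _ x; apply: submod_zeroP.
Qed.

End UpperBound.

Section LowerBound.
Variables (R : nzRingType) (p q : R).
Hypotheses (pq : p * q = 1) (qp : q * p <> 1).

Definition power_annihilator : set R^o :=
  [set r : R | exists k, r * q ^+ k = 0].

Lemma submod_power_annihilator : submodule power_annihilator.
Proof.
split; first by exists 0%N; rewrite mul0r.
move=> a r s [k rk] [l sl]; exists (k + l)%N.
rewrite mulrDl {1}exprD mulrA -[a *: r]/(a * r) -[a * r * _]mulrA rk mulr0 mul0r.
by rewrite addnC exprD mulrA sl mul0r addr0.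
Qed.

(** Were the quotient by the left ideal of all r with r q^k = 0 projective,
    that ideal would be generated by an element killed by a single power q^k;
    but 1 - q^(k+1) p^(k+1), which lies in the ideal, is not killed by q^k. *)
Lemma quot_power_annihilator_not_pdim0 :
  ~ pdim_le (quotmod_type submod_power_annihilator) 0.
Proof.
move=> [P P0].
have augI (x : res_mod P 0) : res_aug P x = 0 -> x = 0.
  by move=> /(res_exact0 (p := P)) [y <-]; rewrite (P0 1%N isT y) linear0.
pose pi : {linear R^o -> quotmod_type submod_power_annihilator} :=
  @quot_proj _ _ _ submod_power_annihilator.
have [|h hE] := @res_proj _ _ P 0%N _ _ pi (res_aug P).
  exact: quot_proj_surj.
have [x xE] := res_aug_surj P (pi 1).
have J1 : power_annihilator (1 - h x).
  by apply/(quot_projP submod_power_annihilator)/esym; rewrite -[RHS]xE; apply: hE.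
have hx0 j : power_annihilator j -> j * h x = 0.
  move=> Jj; rewrite -[j * _]/(j *: (h x)) -linearZ.
  have -> : j *: x = 0; last exact: linear0.
  apply: augI; rewrite linearZ xE -[RHS](linear0 pi) -linearZ.
  by apply/quot_projP; rewrite subr0 -[j *: _]/(j * 1) mulr1.
(* Here 1 - h x lies in the ideal and acts on its elements, from the right,
   as the identity. *)
have pqn n : p ^+ n * q ^+ n = 1.
  elim: n => [|n IH]; first by rewrite !expr0 mulr1.
  by rewrite exprSr exprS mulrA -[_ * p * q]mulrA pq mulr1.
have [k Jk] := J1.
have /hx0 e : power_annihilator (1 - q ^+ k.+1 * p ^+ k.+1).
  by exists k.+1; rewrite mulrBl mul1r -mulrA pqn mulr1 subrr.
apply: qp; apply/esym/eqP; rewrite -subr_eq0 -(pqn k); apply/eqP.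
have : p ^+ k * ((1 - q ^+ k.+1 * p ^+ k.+1) * (1 - h x) * q ^+ k) = 0.
  by rewrite -mulrA Jk !mulr0.
rewrite mulrBr e subr0 mulr1 mulrBl mul1r mulrBr.
rewrite [p ^+ k.+1]exprS [q ^+ k.+1]exprSr !mulrA -!mulrA pqn !mulrA pqn mul1r mulr1.
by [].
Qed.

End LowerBound.

Lemma lgldim_hereditary_eq1 (R : nzRingType) (p q : R) : left_hereditary R ->
  p * q = 1 -> q * p <> 1 -> lgldim R = Some 1%N.
Proof.
move=> herR pq qp; apply: least_eq.
  by move=> M; apply/least_le/pdim_le1.
case=> // _ /(_ (quotmod_type (submod_power_annihilator q))) [m].
move=> em; rewrite leqn0 => /eqP m0; move: em; rewrite m0 => /leastP.
exact: (quot_power_annihilator_not_pdim0 pq qp).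
Qed.

(** * Localization preserves left heredity *)

Section Restriction.
Variables (R Q : nzRingType) (f : {rmorphism R -> Q}) (A : lmodType Q).

Definition restrict (_ : {rmorphism R -> Q}) : Type := A.
HB.instance Definition _ := GRing.Zmodule.on (restrict f).

Definition restrict_scale (a : R) (u : restrict f) : restrict f :=
  f a *: (u : A).

Fact restrict_scaleA a b u :
  restrict_scale a (restrict_scale b u) = restrict_scale (a * b) u.
Proof. by rewrite /restrict_scale scalerA rmorphM. Qed.
Fact restrict_scale1 : left_id 1 restrict_scale.
Proof. by move=> u; rewrite /restrict_scale rmorph1 scale1r. Qed.
Fact restrict_scaleDr : right_distributive restrict_scale +%R.
Proof. by move=> a u v; rewrite /restrict_scale [LHS]scalerDr. Qed.
Fact restrict_scaleDl u : {morph restrict_scale^~ u : a b / a + b}.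
Proof. by move=> a b; rewrite /restrict_scale rmorphD [LHS]scalerDl. Qed.
HB.instance Definition _ := GRing.Zmodule_isLmodule.Build R (restrict f)
  restrict_scaleA restrict_scale1 restrict_scaleDr restrict_scaleDl.

End Restriction.

Section Localization.
Variables (R Q : nzRingType) (S : set R) (f : {rmorphism R -> Q}).
Hypotheses (HS : regular_left_Ore S) (fracf : is_left_fractions S f).

Let f_inj r s : f r = f s -> r = s.
Proof.
case: fracf => _ _ ker e; apply/eqP; rewrite -subr_eq0; apply/eqP.
have /ker [t St] : f (r - s) = 0 by rewrite rmorphB e subrr.
by rewrite -[X in _ = X](mulr0 t); apply: (HS.2 _ St).1.
Qed.

Let f_cancel (A : lmodType Q) s (u v : A) : S s -> f s *: u = f s *: v -> u = v.
Proof.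
by case: fracf => + _ _ => /[apply] -[q [qf _]] e;
  rewrite -[u]scale1r -[v]scale1r -qf -!scalerA e.
Qed.

(** A left ideal L of Q is generated by its trace L0 on R. A linear relation
    over Q restricts to one over R, and a selection h0 on L0 extends to L by
    h (s^-1 r) = s^-1 h0 r. *)
Lemma left_hereditary_fractions : left_hereditary R -> left_hereditary Q.
Proof.
have [[[S1 SM] Ore] _] := HS; have [Sunit Sfrac _] := fracf.
move=> herR L SL A G GL Gt.
pose L0 : set R^o := [set r : R | L (f r)].
have SL0 : submodule L0.
  split; first by rewrite /L0 /= rmorph0; apply: SL.1.
  by move=> a r s Lr Ls; rewrite /L0 /= rmorphD rmorphM; apply: SL.2.
have [] := herR L0 SL0 (restrict A f) (fun r u => G (f r) u).
- by move=> a r s u v Gr Gs; rewrite rmorphD rmorphM; apply: GL.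
- by move=> r /Gt.
move=> h0 [h0L h0G].
have h0M t (r : R) : L0 r -> h0 (t * r) = f t *: (h0 r : A).
  by move=> Lr; apply: (linear_onZ t SL0 h0L Lr).
pose h q : A := xget 0 [set u | exists s r, [/\ S s, f s * q = f r & f s *: u = h0 r]].
have L0P q s r : L q -> f s * q = f r -> L0 r.
  by move=> Lq e; rewrite /L0 /= -e; apply: (submodZ (N := L)).
have hE q s r : L q -> S s -> f s * q = f r -> f s *: h q = h0 r.
  move=> Lq Ss e; have Lr := L0P _ _ _ Lq e.
  have [u ue] : exists u, f s *: u = h0 r.
    have [t [_ ft]] := Sunit _ Ss; exists (t *: (h0 r : A)).
    by rewrite scalerA ft scale1r.
  rewrite /h; case: xgetP => [v _ [s' [r' [Ss' e' ve]]]|]; last first.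
    by move=> /(_ u) []; exists s, r.
  have Lr' := L0P _ _ _ Lq e'.
  have [t [c [St tc]]] := Ore s s' Ss'.
  apply: (f_cancel St); rewrite scalerA -rmorphM tc rmorphM -scalerA ve.
  have er : t * r = c * r'.
    by apply: f_inj; rewrite !rmorphM -e -e' !mulrA -!rmorphM tc.
  by rewrite -!h0M // er.
exists h; split=> [a x y Lx Ly|x Lx]; last first.
  have [s [r [Ss e]]] := Sfrac x.
  have [t [tf _]] := Sunit _ Ss.
  have G0 : G 0 0.
    by have := h0G _ SL0.1; rewrite (linear_on0 SL0 h0L) rmorph0.
  have := GL t _ _ _ _ (h0G _ (L0P _ _ _ Lx e)) G0; rewrite !addr0.
  rewrite -(hE _ _ _ Lx Ss e) scalerA tf scale1r.
  have -> // : t *: (f r : Q^o) = x.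
  by rewrite -e -[LHS]/(t * (f s * x)) mulrA tf mul1r.
have [sx [rx [Sx ex]]] := Sfrac x; have [sy [ry [Sy ey]]] := Sfrac y.
have [sa [ra [Sa ea]]] := Sfrac a.
have [t [c [St tc]]] := Ore ra sx Sx.
have [k [d [Sk kd]]] := Ore (t * sa) sy Sy.
have Sz : S (k * (t * sa)) by auto.
have eax : f (k * (t * sa)) * (a * x) = f (k * c * rx).
  rewrite !rmorphM -ex -!mulrA [f c * _]mulrA -[f c * f sx]rmorphM -tc.
  by rewrite rmorphM -ea -!mulrA.
have eyy : f (k * (t * sa)) * y = f (d * ry).
  by rewrite kd !rmorphM -mulrA ey.
have Lrx := L0P _ _ _ Lx ex; have Lry := L0P _ _ _ Ly ey.
have Lax : L (a * x) by apply: (submodZ (N := L)).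
apply: (f_cancel Sz); rewrite scalerDr.
rewrite (hE _ _ (k * c * rx + d * ry)) //; first last.
- by rewrite mulrDr eax eyy rmorphD.
- exact: SL.2.
rewrite [RHS]addrC (hE _ _ _ Ly Sz eyy) addrC.
rewrite -[k * c * rx + d * ry]/((k * c) *: (rx : R^o) + d * ry) h0L //; last first.
  exact: (submodZ (N := L0)).
congr (_ + _); rewrite scalerA -[LHS]/(f (k * c) *: (h0 rx : A)).
rewrite -(hE _ _ _ Lx Sx ex) scalerA.
by congr (_ *: _); rewrite !rmorphM -!mulrA ea -!rmorphM tc.
Qed.

End Localization.

(** * The operators X, D, J and their relations *)

Section IntegroDifferential.
Variable K : fieldType.
Hypothesis charK0 : [pchar K] =i pred0.
Local Notation I1 := (I1 K).
Implicit Types (r s u v w : I1) (p q g h : {poly K}) (a b c : {poly {poly K}}).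
Implicit Types (L : set I1^o).

Definition ap r : {poly K} -> {poly K} := polyEnd_fun (I1_val r).

Lemma ap_linear r : linear (ap r).
Proof. by move=> a p q; rewrite /ap /polyEnd_fun linearP. Qed.
HB.instance Definition _ r :=
  GRing.isLinear.Build K {poly K} {poly K} _ (ap r) (@ap_linear r).

Lemma ap_inj r s : ap r =1 ap s -> r = s.
Proof. by move=> e; apply: val_inj; apply: polyEndP. Qed.

Lemma apD r s p : ap (r + s) p = ap r p + ap s p. Proof. by []. Qed.
Lemma apM r s p : ap (r * s) p = ap r (ap s p). Proof. by []. Qed.
Lemma ap1 p : ap 1 p = p. Proof. by []. Qed.
Lemma ap0 p : ap 0 p = 0. Proof. by []. Qed.
Lemma apZ (c : K) r p : ap (c *: r) p = c *: ap r p. Proof. by []. Qed.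

Lemma ap_sum (I : finType) (f : I -> I1) p :
  ap (\sum_i f i) p = \sum_i ap (f i) p.
Proof. by elim/big_rec2: _ => //= i u v _ <-. Qed.

Fact opX_I1 : opX K \in @I1_pred K. Proof. exact/asboolP. Qed.
Fact opD_I1 : opD K \in @I1_pred K. Proof. exact/asboolP. Qed.
Fact opInt_I1 : opInt K \in @I1_pred K. Proof. exact/asboolP. Qed.

Definition I1X : I1 := MkI1 opX_I1.
Definition I1D : I1 := MkI1 opD_I1.
Definition I1int : I1 := MkI1 opInt_I1.

Local Notation X := I1X.
Local Notation D := I1D.
Local Notation J := I1int.

(** Induction over the generators of the smallest subalgebra that contains
    X, D and J. *)
Lemma I1_algebra_ind (P : I1 -> Prop) : P 1 ->
  (forall (c : K) r s, P r -> P s -> P (c *: r + s)) ->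
  (forall r s, P r -> P s -> P (r * s)) ->
  P X -> P D -> P J -> forall r, P r.
Proof.
move=> P1 PL PM PX PD PJ r.
have /asboolP : @I1_pred K (I1_val r) by case: r.
move=> /(_ (fun e => `[< exists2 r, I1_val r = e & P r >])) H.
suff /asboolP [s /val_inj <- //] : `[< exists2 s, I1_val s = I1_val r & P s >].
refine (H _ _ _ _); first last.
- by apply/asboolP; exists J.
- by apply/asboolP; exists D.
- by apply/asboolP; exists X.
split=> [|c u v|u v]; first by apply/asboolP; exists 1.
  move=> /asboolP [r1 <- P1r] /asboolP [r2 <- P2r]; apply/asboolP.
  by exists (c *: r1 + r2); auto.
move=> /asboolP [r1 <- P1r] /asboolP [r2 <- P2r]; apply/asboolP.
by exists (r1 * r2); auto.
Qed.

Lemma apX p : ap X p = 'X * p. Proof. by []. Qed.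
Lemma apDn n p : ap (D ^+ n) p = p^`(n).
Proof. by elim: n p => [|n IH] p //; rewrite exprS apM IH. Qed.

Lemma DX : D * X = X * D + 1.
Proof.
apply: ap_inj => p; rewrite apD !apM !apX -[ap D _]/(('X * p)^`()).
by rewrite derivM derivX mul1r addrC.
Qed.

Lemma DXn n : D ^+ n * X = X * D ^+ n + D ^+ n.-1 *+ n.
Proof.
elim: n => [|n IH]; first by rewrite mul1r mulr1 mulr0n addr0.
rewrite exprS -mulrA IH mulrDr mulrA DX mulrDl mul1r -mulrA -exprS -addrA.
congr (_ + _); rewrite mulrnAr /= mulrSr addrC; congr (_ + _).
by case: n {IH} => [|n]; rewrite ?mulr0n //= -exprS.
Qed.

Lemma natK_neq0 n : n.+1%:R != 0 :> K.
Proof. by have /pcharf0P -> := charK0. Qed.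

Lemma coef_int_fun p i :
  (int_fun p)`_i = if i is j.+1 then p`_j / j.+1%:R else 0.
Proof.
rewrite (@int_funE _ (size p + i)) ?leq_addr // coef_sum.
case: i => [|j]; first by rewrite big1 // => j _; rewrite coefZ coefXn mulr0.
have lt_j : (j < size p + j.+1)%N by rewrite addnS ltnS leq_addl.
rewrite (bigD1 (Ordinal lt_j)) //= coefZ coefXn eqxx mulr1 big1 ?addr0 //.
move=> k; rewrite -val_eqE /= => kj; rewrite coefZ coefXn eqSS eq_sym.
by rewrite (negPf kj) mulr0.
Qed.

Lemma DJ : D * J = 1.
Proof.
apply: ap_inj => p; rewrite apM ap1 -[ap D _]/((int_fun p)^`()).
apply/polyP => i; rewrite coef_deriv coef_int_fun -[LHS]mulr_natr
  -mulrA mulVf ?mulr1 //.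
exact: natK_neq0.
Qed.

Lemma DJn n : D ^+ n * J ^+ n = 1.
Proof.
elim: n => [|n IH]; first by rewrite !expr0 mulr1.
by rewrite exprSr exprS mulrA -[_ * D * J]mulrA DJ mulr1.
Qed.

Lemma JD_neq1 : J * D <> 1.
Proof.
move=> /(congr1 (fun r => ap r 1)); rewrite apM ap1 -[ap D _]/(1^`()).
by rewrite derivC linear0 => /eqP; rewrite eq_sym oner_eq0.
Qed.

Definition dpoly p : I1 := horner_alg D p.

Lemma dpolyX : dpoly 'X = D. Proof. exact: horner_algX. Qed.
Lemma dpolyXn n : dpoly 'X^n = D ^+ n.
Proof. by rewrite /dpoly rmorphXn /= horner_algX. Qed.
Lemma dpolyC (c : K) : dpoly c%:P = c%:A. Proof. exact: horner_algC. Qed.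
Lemma dpolyD p q : dpoly (p + q) = dpoly p + dpoly q.
Proof. exact: rmorphD. Qed.
Lemma dpolyM p q : dpoly (p * q) = dpoly p * dpoly q.
Proof. exact: rmorphM. Qed.
Lemma dpoly0 : dpoly 0 = 0. Proof. exact: rmorph0. Qed.
Lemma dpoly1 : dpoly 1 = 1. Proof. exact: rmorph1. Qed.
Lemma dpolyXE n p : dpoly (p ^+ n) = dpoly p ^+ n. Proof. exact: rmorphXn. Qed.
Lemma dpoly_comm p q : dpoly p * dpoly q = dpoly q * dpoly p.
Proof. by rewrite -!dpolyM mulrC. Qed.

Lemma dpoly_mulX p : dpoly p * X = X * dpoly p + dpoly p^`().
Proof.
elim/poly_ind: p => [|p c IH]; first by rewrite deriv0 !dpoly0 mul0r mulr0 addr0.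
rewrite derivD derivM derivX derivC addr0 mulr1 !dpolyD !dpolyM dpolyX dpolyC.
rewrite mulrDl mulrDr -mulrA DX mulrDr mulr1 mulrA IH mulrDl -!mulrA.
rewrite -scalerAl mul1r -scalerAr mulr1.
by rewrite -!addrA; congr (_ + _); rewrite addrA addrC.
Qed.

(** Write g = t^j g1 with g1(0) <> 0. As D is locally nilpotent on K[x], the
    operator g1(D) is invertible there, and only D^j has a kernel. *)
Lemma dpoly_kernel g : g != 0 ->
  exists j, forall p, ap (dpoly g) p = 0 -> ap (D ^+ j) p = 0.
Proof.
move=> g0; have [j [g1 /implyP/(_ g0) g1r ->]] := multiplicity_XsubC g 0.
exists j => p; rewrite dpolyM -[_ ^+ j]/(('X - 0%:P) ^+ j) subr0 apM dpolyXn => e.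
set z := ap _ p in e *; set m := size z.
have /Bezout_eq1_coprimepP [[a b] /= ab] : coprimep g1 'X^m.
  by rewrite coprimep_expr // -['X]subr0 coprimep_XsubC.
rewrite -[z]ap1 -dpoly1 -ab dpolyD !dpolyM apD !apM e linear0 add0r dpolyXn apDn.
by rewrite derivn_poly0 // linear0.
Qed.

Definition onto r : Prop := forall p, exists q, ap r q = p.

Lemma ontoM r s : onto r -> onto s -> onto (r * s).
Proof. by move=> rP sP p; have [q <-] := rP p; have [z <-] := sP q; exists z. Qed.

Lemma onto_Dn n : onto (D ^+ n).
Proof. by move=> p; exists (ap (J ^+ n) p); rewrite -apM DJn. Qed.

Lemma onto_dpoly g : g != 0 -> onto (dpoly g).
Proof.
move=> g0; have [j [g1 /implyP/(_ g0) g1r ->]] := multiplicity_XsubC g 0.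
rewrite dpolyM subr0 dpolyXn; apply: ontoM (@onto_Dn j) => p.
have /Bezout_eq1_coprimepP [[a b] /= ab] : coprimep g1 'X^(size p).
  by rewrite coprimep_expr // -['X]subr0 coprimep_XsubC.
exists (ap (dpoly a) p); rewrite -apM -dpolyM mulrC.
rewrite -[RHS]ap1 -dpoly1 -ab dpolyD [in RHS]apD [in X in _ + X]dpolyM dpolyXn apM apDn.
by rewrite derivn_poly0 // linear0 addr0.
Qed.

(** Surjective operators are the source of all right regular elements used
    below. *)
Lemma onto_rreg r s : onto s -> r * s = 0 -> r = 0.
Proof.
move=> sP rs; apply: ap_inj => p; have [q <-] := sP p.
by rewrite -apM rs.
Qed.

(** * Differential operators with polynomial coefficients *)

(** The coefficients are polynomials in D, written on the right; the variable
    of the outer polynomial ring stands for X. *)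
Definition diffop a : I1 := \sum_(i < size a) X ^+ i * dpoly a`_i.

Lemma diffopE n a :
  (size a <= n)%N -> diffop a = \sum_(i < n) X ^+ i * dpoly a`_i.
Proof.
move=> le_an; rewrite /diffop (big_ord_widen n (fun i => X ^+ i * dpoly a`_i) le_an).
rewrite big_mkcond /=; apply: eq_bigr => i _; case: ltnP => // le_ai.
by rewrite nth_default // dpoly0 mulr0.
Qed.

Lemma diffopD a b : diffop (a + b) = diffop a + diffop b.
Proof.
pose n := maxn (size a) (size b).
rewrite !(@diffopE n) ?size_polyD ?leq_maxl ?leq_maxr // -big_split /=.
by apply: eq_bigr => i _; rewrite coefD dpolyD mulrDr.
Qed.

Lemma diffopN a : diffop (- a) = - diffop a.
Proof.
rewrite /diffop size_polyN -sumrN; apply: eq_bigr => i _.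
by rewrite coefN /dpoly rmorphN mulrN.
Qed.

Lemma diffopB a b : diffop (a - b) = diffop a - diffop b.
Proof. by rewrite diffopD diffopN. Qed.

Lemma diffop0 : diffop 0 = 0.
Proof. by rewrite /diffop size_poly0 big_ord0. Qed.

Lemma diffopMX a : diffop (a * 'X) = X * diffop a.
Proof.
rewrite (@diffopE (size a).+1) ?size_polyMX_leq //; last first.
  by have [->|a0] := eqVneq a 0; rewrite ?mul0r ?size_poly0 // size_mulX.
rewrite big_ord_recl /= coefMX /= dpoly0 mulr0 add0r /diffop mulr_sumr.
by apply: eq_bigr => i _; rewrite coefMX /= /bump add1n exprS mulrA.
Qed.

Lemma diffopMXn a n : diffop (a * 'X^n) = X ^+ n * diffop a.
Proof.
elim: n => [|n IH]; first by rewrite !expr0 mulr1 mul1r.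
by rewrite exprSr mulrA diffopMX IH exprS mulrA.
Qed.

Lemma diffopMC a q : diffop (a * q%:P) = diffop a * dpoly q.
Proof.
have le_s : (size (a * q%:P)%R <= size a)%N.
  have [->|q0] := eqVneq q 0; first by rewrite mulr0 size_poly0.
  by rewrite mulrC mul_polyC size_scale.
rewrite (diffopE le_s) /diffop mulr_suml; apply: eq_bigr => i _.
by rewrite coefMC dpolyM mulrA.
Qed.

Lemma diffopC q : diffop q%:P = dpoly q.
Proof.
have -> : q%:P = 1 * q%:P by rewrite mul1r.
by rewrite diffopMC /diffop size_poly1 big_ord1 mul1r coefC dpoly1 mul1r.
Qed.

(** The first two terms of the Leibniz rule; the second one is the leading
    term of the commutator with p(D). *)
Lemma dpoly_diffop p a :
  exists2 c : {poly {poly K}}, (size c <= (size a).-2)%N &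
  dpoly p * diffop a = diffop (a * p%:P + a^`() * (p^`())%:P + c).
Proof.
elim/poly_ind: a p => [|a q IH] p.
  exists 0; first by rewrite size_poly0.
  by rewrite deriv0 !mul0r !addr0 diffop0 mulr0.
have [a0|a0] := eqVneq a 0.
  exists 0; first by rewrite size_poly0.
  rewrite a0 mul0r add0r derivC mul0r !addr0 diffopC -polyCM diffopC -dpolyM.
  by rewrite mulrC.
have [c1 sc1 e1] := IH p; have [c2 sc2 e2] := IH p^`().
exists (c1 * 'X + a^`() * (p^`()^`())%:P + c2).
  rewrite size_MXaddC (negPf a0) /=.
  have lt0 : (0 < size a)%N by rewrite size_poly_gt0.
  have ltc2 : (size c2 <= (size a).-1)%N by apply: leq_trans sc2 (leq_pred _).
  have ltc1 : (size (c1 * 'X)%R <= (size a).-1)%N.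
    have [->|c10] := eqVneq c1 0; first by rewrite mul0r size_poly0.
    rewrite size_mulX //; case: (size a) sc1 => [|[|n]] //=;
      by rewrite leqn0 size_poly_eq0 (negPf c10).
  have ltd : (size (a^`() * (p^`()^`())%:P)%R <= (size a).-1)%N.
    rewrite mulrC mul_polyC; apply: leq_trans (size_scale_leq _ _) _.
    by rewrite -ltnS prednK // lt_size_deriv.
  apply: leq_trans (size_polyD _ _) _; rewrite geq_max ltc2 andbT.
  by apply: leq_trans (size_polyD _ _) _; rewrite geq_max ltc1 ltd.
rewrite diffopD diffopC diffopMX mulrDr mulrA dpoly_mulX mulrDl -mulrA e1 e2 -dpolyM -diffopMX.
rewrite -diffopC -!diffopD; congr diffop.
rewrite derivD derivM derivX derivC addr0 mulr1 polyCM; ring.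
Qed.

(** Since [g^(N+1), X] = (N+1) g' g^N, moving a power of g(D) to the left
    across X costs one factor g(D). *)
Lemma Xn_dpoly_power g N i :
  exists y, X ^+ i * dpoly g ^+ (N + i) = dpoly g ^+ N * y.
Proof.
elim: i N => [|i IH] N; first by exists 1; rewrite addn0 mul1r mulr1.
have [y e] := IH N.+1.
have [z ez] : exists z, X * dpoly g ^+ N.+1 = dpoly g ^+ N * z.
  exists (dpoly g * X - dpoly (g^`() *+ N.+1)).
  have := dpoly_mulX (g ^+ N.+1); rewrite dpolyXE => /esym /(canRL (addrK _)) ->.
  rewrite deriv_exp /= mulrBr mulrA -exprSr; congr (_ - _).
  by rewrite -dpolyXE -dpolyM; congr dpoly; rewrite -mulrnAl mulrC.
by exists (z * y); rewrite addnS -addSn exprS -mulrA e !mulrA ez.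
Qed.

Lemma diffop_dpoly_power g N b :
  exists y, diffop b * dpoly g ^+ (N + size b) = dpoly g ^+ N * y.
Proof.
rewrite /diffop mulr_suml.
elim/big_rec: _ => [|i _ _ [z ->]]; first by exists 0; rewrite mulr0.
have [y e] := Xn_dpoly_power g N i.
exists (y * dpoly g ^+ (size b - i) * dpoly b`_i + z); rewrite mulrDr; congr (_ + _).
have -> : (N + size b = N + i + (size b - i))%N.
  by rewrite -addnA subnKC // ltnW.
by rewrite -mulrA -dpolyXE dpoly_comm dpolyXE exprD !mulrA e.
Qed.

Definition is_diffop r : Prop := exists a, r = diffop a.

Lemma is_diffopD r s : is_diffop r -> is_diffop s -> is_diffop (r + s).
Proof. by move=> [a ->] [b ->]; exists (a + b); rewrite diffopD. Qed.

Lemma is_diffop_dpoly p : is_diffop (dpoly p).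
Proof. by exists p%:P; rewrite diffopC. Qed.

Lemma is_diffopM r s : is_diffop r -> is_diffop s -> is_diffop (r * s).
Proof.
move=> [a ->] [b ->]; rewrite /diffop mulr_suml.
elim/big_rec: _ => [|i r' _ IH]; first by exists 0; rewrite diffop0.
apply: is_diffopD IH; rewrite -mulrA; have [c _ ->] := dpoly_diffop a`_i b.
by rewrite -diffopMXn; eexists.
Qed.

Lemma is_diffop_Dn n : is_diffop (D ^+ n).
Proof. by rewrite -dpolyXn; apply: is_diffop_dpoly. Qed.

(** Given any l, a large power of D moves r into the Weyl algebra times D^l;
    keeping l arbitrary makes the property stable under products. *)
Lemma D_power_is_diffop r l :
  exists k, exists2 y, is_diffop y & D ^+ k * r = y * D ^+ l.
Proof.
have op1 : is_diffop 1 by rewrite -(expr0 D); apply: is_diffop_Dn.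
have opX : is_diffop X by exists 'X; rewrite -['X]mul1r diffopMX -polyC1 diffopC dpoly1 mulr1.
elim/I1_algebra_ind: r l => [l|z r s IHr IHs l|r s IHr IHs l|l|l|l].
- by exists l, 1; rewrite // mulr1 mul1r.
- have [k [y oy ey]] := IHr l; have [k' [y' oy' ey']] := IHs l.
  exists (k' + k)%N, (D ^+ k' * (z *: y) + D ^+ k * y').
    apply: is_diffopD; apply: is_diffopM => //; try exact: is_diffop_Dn.
    rewrite -mulr_algl -dpolyC.
    by apply: is_diffopM (is_diffop_dpoly _) oy.
  rewrite mulrDr mulrDl; congr (_ + _).
    by rewrite exprD -!mulrA -scalerAr ey scalerAl.
  by rewrite addnC exprD -!mulrA ey'.
- have [k [y oy ey]] := IHs l; have [k' [y' oy' ey']] := IHr k.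
  exists k', (y' * y); first exact: is_diffopM.
  by rewrite mulrA ey' -!mulrA ey.
- exists l.+1, (X * D + l.+1%:R).
    apply: is_diffopD; first by apply: is_diffopM opX (is_diffop_Dn 1).
    by rewrite -(rmorph_nat (@horner_alg K I1 D)); apply: is_diffop_dpoly.
  by rewrite DXn mulrDl -mulrA -exprS mulr_natl.
- by exists l, D; rewrite -?exprS -?exprSr //; apply: is_diffop_Dn 1%N.
- by exists l.+1, 1; rewrite // exprSr -mulrA DJ // mulr1 mul1r.
Qed.

Lemma D_power_diffop r : exists k a, D ^+ k * r = diffop a.
Proof.
by have [k [y [a ->] e]] := D_power_is_diffop r 0; exists k, a; rewrite e mulr1.
Qed.

(** * The ideal F and its submodules *)

(** F is the ideal of the finite-rank operators: the image of r is killed by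
    some D^k if and only if it lies in a finite-dimensional subspace of
    K[x]. *)
Definition socle : set I1^o := [set r : I1 | exists k, D ^+ k * r = 0].
Local Notation F := socle.

Lemma F_D k r : F (D ^+ k * r) <-> F r.
Proof.
split=> [[n]|[n e]]; first by rewrite mulrA -exprD; exists (n + k)%N.
by exists n; rewrite mulrA -exprD addnC exprD -mulrA e mulr0.
Qed.

Lemma submod_F : submodule F.
Proof.
split; first by exists 0%N; rewrite mulr0.
move=> z r s [k rk] [l sl]; have [n [y _ e]] := D_power_is_diffop z k.
exists (l + n)%N; rewrite mulrDr -[z *: r]/(z * r) [in X in _ + X]addnC.
rewrite !exprD -!mulrA sl !mulr0 addr0 [D ^+ n * _]mulrA e.
by rewrite -mulrA rk !mulr0.
Qed.

Let SF := submod_F.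

Lemma F_mulr r s : F r -> F (r * s).
Proof. by move=> [k e]; exists k; rewrite mulrA e mul0r. Qed.

Lemma F_defect k r : F (r - J ^+ k * (D ^+ k * r)).
Proof. by exists k; rewrite mulrBr [D ^+ k * (J ^+ k * _)]mulrA DJn // mul1r subrr. Qed.

(** By [dpoly_kernel], g(D) kills no more of K[x] than a power of D does. *)
Lemma F_dpoly g r : g != 0 -> F (dpoly g * r) -> F r.
Proof.
move=> g0 [k]; rewrite mulrA -dpolyXn -dpolyM => e.
have gX0 : 'X^k * g != 0 by rewrite mulf_neq0 // expf_neq0 // polyX_eq0.
have [j jP] := dpoly_kernel gX0.
by exists j; apply: ap_inj => p; rewrite apM; apply: jP; rewrite -apM e.
Qed.

Lemma deriv_eq0_const p : p^`() = 0 -> p = (p`_0)%:P.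
Proof.
move=> dp; apply/polyP => -[|i]; rewrite coefC //=.
have /eqP : (p^`())`_i = 0 by rewrite dp coef0.
by rewrite coef_deriv -mulr_natr mulf_eq0 (negPf (natK_neq0 i)) orbF => /eqP.
Qed.

Lemma ap_const w p : D * w = 0 -> ap w p = ((ap w p)`_0)%:P.
Proof.
move=> Dw; apply: deriv_eq0_const.
by rewrite -[LHS]/(ap D (ap w p)) -apM Dw.
Qed.

Lemma apX_alg p q : ap (horner_alg X p) q = p * q.
Proof.
elim/poly_ind: p q => [|p c IH] q; first by rewrite rmorph0 mul0r.
rewrite rmorphD rmorphM /= horner_algX horner_algC apD apM apX IH.
by rewrite mulrDl mulrA; congr (_ + _); rewrite mul_polyC.
Qed.

Lemma ap_neq0 r : r <> 0 -> exists p, ap r p <> 0.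
Proof.
move=> r0; apply: contrapT => none; apply: r0; apply: ap_inj => p.
by apply: contrapT => rp; apply: none; exists p.
Qed.

(** An operator w with D w = 0 is a linear form on K[x], with values in the
    constants. For f with w f = 1, the multiplication by f is a generalized
    inverse of w, so that I1 w is a direct summand of I1. *)
Lemma row_regular w : D * w = 0 -> exists s, w * s * w = w.
Proof.
move=> Dw; have [->|/ap_neq0 [p]] := pselect (w = 0).
  by exists 0; rewrite !mulr0.
rewrite (ap_const p Dw); set z := _`_0 => z0.
have {}z0 : z != 0 by apply: contra_notN z0 => /eqP ->.
exists (z^-1 *: horner_alg X p); apply: ap_inj => q; rewrite !apM.
rewrite (ap_const q Dw) apZ apX_alg mulrC mul_polyC scalerA linearZ /=.
rewrite (ap_const p Dw) -/z -mul_polyC -polyCM; congr _%:P.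
by rewrite mulrAC mulVf // mul1r.
Qed.

(** The module I1 w is simple: r w maps into the line of the polynomial
    h = r(1), and a multiple of a power of D sends h to 1. *)
Lemma row_simple r w : D * w = 0 -> r * w <> 0 -> exists s, s * (r * w) = w.
Proof.
move=> Dw /ap_neq0 [p]; rewrite apM (ap_const p Dw) -[_%:P]mulr1 mul_polyC.
set h := ap r 1; rewrite linearZ /= -/h => rh0.
have h0 : h != 0 by apply: contra_notN rh0 => /eqP ->; rewrite scaler0.
set n := (size h).-1.
have eh : h^`(n) = (h^`(n)`_0)%:P.
  apply: deriv_eq0_const; rewrite -derivnS derivn_poly0 // /n prednK //.
  by rewrite size_poly_gt0.
have hn0 : h^`(n)`_0 != 0.
  rewrite coef_derivn addn0 ffactnn -mulr_natr mulf_neq0 //.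
    by rewrite -[_`_n]/(lead_coef h) lead_coef_eq0.
  by rewrite -(prednK (fact_gt0 n)) natK_neq0.
exists ((h^`(n)`_0)^-1 *: D ^+ n); apply: ap_inj => q.
rewrite !apM apZ (ap_const q Dw) -[_%:P]mulr1 mul_polyC linearZ /= -/h.
rewrite apDn derivnZ eh -!mul_polyC -!polyCM ?mulr1; congr _%:P.
by rewrite coefC mulrCA mulVf ?mulr1.
Qed.

(** With k minimal such that some r in N outside N' satisfies D^k r = 0, the
    element D r lies in N'; hence w = r - J D r still lies outside N', and
    D w = 0. *)
Lemma F_row_witness (N N' : set I1^o) : submodule N -> submodule N' ->
  N `<=` F -> N' `<=` N -> N' <> N ->
  exists w, [/\ D * w = 0, N w & ~ N' w].
Proof.
move=> SN SN' NF N'N neN.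
have exk : exists k, `[< exists r, [/\ N r, ~ N' r & D ^+ k * r = 0] >].
  apply: contrapT => none; apply: neN; rewrite eqEsubset; split=> // r Nr.
  apply: contrapT => nr; apply: none; have [k e] := NF _ Nr.
  by exists k; apply/asboolP; exists r.
case: (ex_minnP exk) => -[|k] /asboolP [r [Nr nr e]] mink.
  by case: nr; rewrite -[r]mul1r -(expr0 D) e; apply: SN'.1.
have NDr : N (D * r) by apply: (submodZ (N := N)).
have N'Dr : N' (D * r).
  apply: contrapT => nDr; have : (k.+1 <= k)%N.
    by apply: mink; apply/asboolP; exists (D * r); rewrite mulrA -exprSr.
  by rewrite ltnn.
have N'JDr : N' (J * (D * r)) by apply: (submodZ (N := N')).
exists (r - J * (D * r)); split.
- by rewrite mulrBr [D * (J * _)]mulrA DJ // mul1r subrr.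
- by apply: (submodB (N := N)) => //; apply: N'N.
- by move=> /(submodD SN' N'JDr); rewrite addrC subrK.
Qed.

Lemma F_selection_extension (A : lmodType I1) (N N0 : set I1^o)
    (G : I1^o -> A -> Prop) (h0 : I1^o -> A) :
  submodule N -> N `<=` F -> submodule N0 -> N0 `<=` N ->
  linear_rel G -> (forall x, N x -> exists u : A, G x u) -> selects N0 G h0 ->
  exists2 h, selects N G h & forall x, N0 x -> h x = h0 x.
Proof.
move=> SN NF SN0 N0N GL Gt sel0.
apply: (@selection_extension _ _ _ [set N' | submodule N' /\ N' `<=` N]) => //.
- move=> C [C0 CC0] CS totC; split.
    split; first by exists C0 => //; have [[]] := CS _ CC0.
    move=> z x y [U CU Ux] [V CV Vy].
    have [UV|VU] := totC _ _ CU CV.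
      by exists V => //; apply: (CS _ CV).1.2 => //; apply: UV.
    by exists U => //; apply: (CS _ CU).1.2 => //; apply: VU.
  by move=> x [U CU Ux]; apply: (CS _ CU).2.
- move=> N' [SN' N'N] _ neN.
  have [w [Dw Nw nw]] := F_row_witness SN SN' NF N'N neN.
  pose P : set I1^o := [set r * w | r in [set: I1]].
  have SP : submodule P.
    split; first by exists 0; rewrite ?mul0r.
    move=> z _ _ [r _ <-] [s _ <-]; exists (z * r + s) => //.
    by rewrite mulrDl -mulrA.
  exists P; split=> //.
  + have [s sE] := row_regular Dw.
    apply: (projOn_retract (N' := [set: I1^o]) (i := fun y : I1^o => y * s : I1^o)
      (r := fun y : I1^o => y * w : I1^o)) => //.
    * by move=> z x y _ _; rewrite mulrDl -mulrA.
    * by move=> z x y _ _; rewrite mulrDl -mulrA.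
    * by move=> y _; exists y.
    * by move=> _ [r _ <-]; rewrite -!mulrA [w * _]mulrA sE.
    * exact: projOn_ring.
  + move=> y N'y [r _ e]; rewrite -e in N'y *; apply: contrapT => rw0.
    have [s se] := row_simple Dw rw0; apply: nw; rewrite -se.
    exact: (submodZ (N := N')).
  + split; first exact: submod_sum.
    apply: sumsub_min => // _ [r _ <-].
    exact: (submodZ (N := N)).
  + by move=> sub; apply: nw; apply: sub; exists 1; rewrite ?mul1r.
Qed.

Lemma projOn_sub_F (N : set I1^o) : submodule N -> N `<=` F -> projOn N.
Proof.
move=> SN NF A G GL Gt.
have [u Gu] := Gt _ SN.1.
have [||h sel _] := @F_selection_extension A N [set 0] G (fun=> 0) SN NF
   (submod0 _) _ GL Gt; last by exists h.
  by move=> _ ->; apply: SN.1.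
split=> [z x y _ _|_ ->]; first by rewrite scaler0 addr0.
by have := GL (-1) _ _ _ _ Gu Gu; rewrite !scaleN1r !addNr.
Qed.

Lemma F_retraction (N : set I1^o) : submodule N -> N `<=` F ->
  exists rho : I1^o -> I1^o, [/\ linear_on F rho,
    forall x, F x -> N (rho x) & forall x, N x -> rho x = x].
Proof.
move=> SN NF.
have [|||h [hL hN] hE] := @F_selection_extension I1^o F N (fun _ y => N y) id
   submod_F (fun _ => id) SN NF; last by exists h.
- by move=> z x y u v; apply: SN.2.
- by move=> x _; exists 0; apply: SN.1.
- by split.
Qed.

(** F is semisimple, so the intersection of L and F has a complement in F,
    which is projective and which L + F adds to L as a direct summand. *)
Lemma projOn_sum_F (L : set I1^o) :
  submodule L -> projOn L <-> projOn (sumsub L F).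
Proof.
move=> SL; have SLF := submod_sum SL SF.
(* The retraction rho of F onto its intersection with L extends to a
   retraction k of L + F onto L. *)
have [|rho [rhoL rhoN rhoE]] := F_retraction (submodI SL SF); first by move=> x [].
pose k z : I1^o := xget 0 [set y | exists l f, [/\ L l, F f, z = l + f & y = l + rho f]].
have kE l f : L l -> F f -> k (l + f) = l + rho f.
  move=> Ll Ff; rewrite /k; case: xgetP => [y _ [l' [f' [Ll' Ff' e ->]]]|]; last first.
    by move=> /(_ (l + rho f)) []; exists l, f.
  have d : l' - l = f - f'.
    by apply/eqP; rewrite subr_eq addrAC eq_sym subr_eq eq_sym -e addrC.
  have Lf : (L `&` F) (f - f') by split; [rewrite -d|]; apply: submodB.
  have := rhoE _ Lf; rewrite (linear_onB rhoL) // -d => /eqP.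
  by rewrite subr_eq addrAC eq_sym subr_eq => /eqP ->; rewrite addrC.
have kL : linear_on (sumsub L F) k.
  move=> z _ _ [l [f [Ll Ff ->]]] [l' [f' [Ll' Ff' ->]]].
  rewrite scalerDr addrACA !kE //; [|exact: SL.2|exact: SF.2].
  by rewrite rhoL // scalerDr addrACA.
have kN x : sumsub L F x -> L (k x).
  move=> [l [f [Ll Ff ->]]]; rewrite kE //; apply: submodD => //.
  by have [] := rhoN _ Ff.
have kid l : L l -> k l = l.
  move=> Ll; rewrite -{1}[l]addr0 kE // ?(linear_on0 SF rhoL) ?addr0 //.
  exact: SF.1.
split=> [PL|].
  apply: (projOn_ext SLF SL kL kN _ PL).
    by move=> y Ly; exists y; rewrite ?kid //; apply: subset_sumsubl.
  apply: projOn_sub_F.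
    split; first by split; [exact: SLF.1 | exact: linear_on0 SLF kL].
    move=> z x y [LFx kx] [LFy ky]; split; first exact: SLF.2.
    by rewrite kL // kx ky scaler0 addr0.
  move=> _ [[l [f [Ll Ff ->]]]]; rewrite kE // => /eqP; rewrite addr_eq0 => /eqP ->.
  rewrite addrC; apply: submodB => //; by have [] := rhoN _ Ff.
apply: (projOn_retract (i := id) (r := k)) => //.
by move=> x Lx; apply: subset_sumsubl.
Qed.

(** * Surjectivity up to powers of D *)

Lemma eventually_nonroot h : h != 0 ->
  exists N, forall j : nat, (N <= j)%N -> h.[j%:R] != 0.
Proof.
have [n] := ubnP (size h); elim: n h => // n IH h lt_n h0.
have [[j /factor_theorem [h1 e]]|none] := pselect (exists j : nat, root h j%:R).
  have h10 : h1 != 0 by apply: contraNneq h0; rewrite e => ->; rewrite mul0r.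
  have [|//|N NP] := IH h1.
    by move: lt_n; rewrite e size_Mmonic ?monicXsubC // size_XsubC; lia.
  exists (maxn N j.+1) => i; rewrite geq_max => /andP [Ni ji].
  rewrite e hornerM hornerXsubC mulf_neq0 ?NP // -natrB 1?ltnW //.
  by rewrite -(prednK (n := (i - j)%N)) ?subn_gt0 // natK_neq0.
by exists 0%N => j _; apply/negP => rj; apply: none; exists j.
Qed.

Definition ffact_poly m : {poly K} := \prod_(l < m) ('X - (l%:R)%:P).

Lemma size_ffact_poly m : size (ffact_poly m) = m.+1.
Proof. by rewrite size_prod_XsubC [index_enum _]unlock -enumT size_enum_ord. Qed.

Lemma ffact_poly_monic m : (ffact_poly m)`_m = 1.
Proof.
have : ffact_poly m \is monic by apply: monic_prod_XsubC.
by rewrite monicE lead_coefE size_ffact_poly => /eqP.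
Qed.

Lemma horner_ffact_poly m j : (ffact_poly m).[j%:R] = (j ^_ m)%:R.
Proof.
rewrite /ffact_poly; elim: m => [|m IH]; first by rewrite big_ord0 hornerC.
rewrite big_ord_recr /= hornerM IH hornerXsubC ffactnSr natrM.
have [le_mj|lt_jm] := leqP m j; first by rewrite natrB.
by rewrite ffact_small // !mul0r.
Qed.

Lemma ffact_poly_free n (be : nat -> K) :
  (exists2 m, (m < n)%N & be m != 0) ->
  \sum_(m < n) be m *: ffact_poly m != 0.
Proof.
elim: n => [[]//|n IH [m]]; rewrite ltnS leq_eqVlt big_ord_recr /=.
have [ben|ben] := eqVneq (be n) 0.
  rewrite ben scale0r addr0 => /orP[/eqP ->|lt_mn bem]; first by rewrite ben eqxx.
  by apply: IH; exists m.
move=> _ _; apply: contraNneq ben => /(congr1 (fun p : {poly K} => p`_n)).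
rewrite coefD coefZ ffact_poly_monic mulr1 coef_sum big1 ?add0r ?coef0 => [-> //|i _].
by rewrite coefZ nth_default ?mulr0 // size_ffact_poly.
Qed.

Lemma ap_dpoly n p q : (size p <= n)%N ->
  ap (dpoly p) q = \sum_(m < n) p`_m *: q^`(m).
Proof.
move=> le_n; rewrite -{1}[p](@take_poly_id _ n) // /take_poly poly_def.
rewrite /dpoly rmorph_sum /= -[LHS]/(ap _ q).
rewrite ap_sum; apply: eq_bigr => m _.
by rewrite -mul_polyC -/(dpoly _) dpolyM dpolyC dpolyXn apM apZ ap1 apDn.
Qed.

(** The monomial X^i D^m sends x^j to a multiple of x^(j + i - m). With w - M
    the largest value of i - m that occurs in the operator, the coefficient of
    x^(j + w - M) in the image of x^j is a nonzero polynomial in j, hence is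
    nonzero for large j. *)
Lemma diffop_Xn_leading a : a != 0 -> exists N w M : nat, forall j, (N <= j)%N ->
  (w + j >= M)%N /\ exists2 z, z != 0 &
  exists q, (size q <= w + j - M)%N /\ ap (diffop a) 'X^j = z *: 'X^(w + j - M) + q.
Proof.
move=> a0; pose n := size a.
pose M := \max_(i < n) size (a`_i)%R.
have leM i : (i < n)%N -> (size (a`_i)%R <= M)%N.
  by move=> lt_in; apply: (leq_bigmax (Ordinal lt_in)).
pose Q k := [exists i : 'I_n, [exists m : 'I_M, (a`_i`_m != 0) && (i + M == k + m)%N]].
have exQ : exists k, Q k.
  have lt_n : (n.-1 < n)%N by rewrite prednK // size_poly_gt0.
  pose p := a`_n.-1; have p0 : p != 0 by rewrite -[p]/(lead_coef a) lead_coef_eq0.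
  have lt_p : ((size p).-1 < M)%N.
    by apply: leq_trans (leM _ lt_n); rewrite prednK // size_poly_gt0.
  exists (n.-1 + M - (size p).-1)%N; apply/existsP; exists (Ordinal lt_n).
  apply/existsP; exists (Ordinal lt_p) => /=.
  rewrite -[_`_(size p).-1]/(lead_coef p) lead_coef_eq0 p0 /= subnK //.
  by rewrite (leq_trans (ltnW lt_p)) // leq_addl.
have ubQ k : Q k -> (k <= n + M)%N.
  by move=> /existsP [[i lti] /existsP [[m ltm] /= /andP [_ /eqP]]]; lia.
case: (ex_maxnP exQ ubQ) => w Qw maxw.
(* For each m at most one i contributes to the sum. *)
pose be m := \sum_(i < n | (i + M == w + m)%N) a`_i`_m.
have h0 : \sum_(m < M) be m *: ffact_poly m != 0.
  apply: ffact_poly_free; move: Qw => /existsP [i /existsP [m /andP [aim /eqP e]]].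
  exists m => //; rewrite /be (bigD1 i) /=; last by rewrite e.
  rewrite big1 ?addr0 // => k /andP [/eqP ek]; rewrite -val_eqE /= => /eqP ki.
  by exfalso; apply: ki; apply: (@addIn M); rewrite ek e.
have [N NP] := eventually_nonroot h0.
exists (maxn N M), w, M => j; rewrite geq_max => /andP [Nj Mj].
split; first by lia.
pose mono (i m : nat) : {poly K} := (a`_i`_m * (j ^_ m)%:R) *: 'X^(i + (j - m)).
have apE : ap (diffop a) 'X^j = \sum_(i < n) \sum_(m < M) mono i m.
  rewrite /diffop ap_sum; apply: eq_bigr => i _.
  have apXn k q : ap (X ^+ k) q = 'X^k * q.
    elim: k => [|k IH]; first by rewrite !expr0 mul1r.
    by rewrite exprS apM IH apX exprS mulrA.
  rewrite apM apXn (@ap_dpoly M) ?leM // mulr_sumr; apply: eq_bigr => m _.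
  by rewrite derivnXn -scaler_nat scalerA -scalerAr -exprD.
have monoP i m : (i < n)%N -> (m < M)%N -> a`_i`_m != 0 -> (i + M <= w + m)%N.
  move=> lti ltm aim; rewrite leqNgt; apply/negP => lt.
  have := maxw (i + M - m)%N; suff : Q (i + M - m)%N by move=> /[swap] /[apply]; lia.
  apply/existsP; exists (Ordinal lti); apply/existsP; exists (Ordinal ltm).
  by rewrite aim /=; lia.
set t := (w + j - M)%N.
exists (\sum_(m < M) be m *: ffact_poly m).[j%:R]; first exact: NP.
set z := horner _ _.
exists (ap (diffop a) 'X^j - z *: 'X^t); split; last by rewrite addrC subrK.
have sz : (size (ap (diffop a) 'X^j - z *: 'X^t)%R <= t.+1)%N.
  apply: leq_trans (size_polyD _ _) _; rewrite size_polyN geq_max; apply/andP; split.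
    rewrite apE; apply: leq_trans (size_sum _ _ _) _; apply/bigmax_leqP => i _.
    apply: leq_trans (size_sum _ _ _) _; apply/bigmax_leqP => m _.
    rewrite /mono; have [->|aim] := eqVneq a`_i`_m 0.
      by rewrite mul0r scale0r size_poly0.
    apply: leq_trans (size_scale_leq _ _) _; rewrite size_polyXn ltnS.
    by have := monoP i m (ltn_ord i) (ltn_ord m) aim; have := ltn_ord m; lia.
  by apply: leq_trans (size_scale_leq _ _) _; rewrite size_polyXn.
have ct : (ap (diffop a) 'X^j - z *: 'X^t)`_t = 0.
  rewrite coefB coefZ coefXn eqxx mulr1 apE coef_sum.
  apply/eqP; rewrite subr_eq0; apply/eqP.
  under eq_bigr => i _ do rewrite coef_sum.
  rewrite exchange_big /z horner_sum; apply: eq_bigr => m _ /=.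
  rewrite hornerZ horner_ffact_poly /be mulr_suml [RHS]big_mkcond /=.
  apply: eq_bigr => i _; rewrite coefZ coefXn.
  have -> : (t == i + (j - m))%N = (i + M == w + m)%N.
    by have ltm := ltn_ord m; rewrite /t; apply/idP/idP => /eqP ?; apply/eqP; lia.
  by case: eqP; rewrite ?mulr1 ?mulr0.
move: sz; rewrite leq_eqVlt => /orP[/eqP e|]; last by rewrite ltnS.
have : lead_coef (ap (diffop a) 'X^j - z *: 'X^t) = 0 by rewrite lead_coefE e.
by move=> /eqP; rewrite lead_coef_eq0 => /eqP ->; rewrite size_poly0.
Qed.

(** By [diffop_Xn_leading] the image of the operator together with the
    polynomials of bounded degree spans K[x]; a power of D kills the latter. *)
Lemma onto_Dn_diffop a : a != 0 -> exists k, onto (D ^+ k * diffop a).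
Proof.
move=> /diffop_Xn_leading [N [w [M leadP]]].
have reach p : exists q, (size (p - ap (diffop a) q)%R <= N + w)%N.
  have [n] := ubnP (size p); elim: n p => // n IH p lt_n.
  have [le_p|lt_p] := leqP (size p) (N + w).
    by exists 0; rewrite linear0 subr0.
  pose j := ((size p).-1 + M - w)%N.
  have Nj : (N <= j)%N by rewrite /j; lia.
  have [_ [z z0 [q [szq e]]]] := leadP j Nj.
  have ej : (w + j - M = (size p).-1)%N by rewrite /j; lia.
  rewrite ej in szq e.
  pose p1 := p - ap (diffop a) ((lead_coef p / z) *: 'X^j).
  have [|y le_y] := IH p1.
    rewrite ltnS in lt_n; apply: leq_trans lt_n.
    have ep : p1 = (p - lead_coef p *: 'X^((size p).-1)) - (lead_coef p / z) *: q.
      by rewrite /p1 linearZ /= e scalerDr scalerA divfK // opprD addrA.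
    have lt0 : (0 < size p)%N by lia.
    rewrite -(prednK lt0) ltnS ep; apply: leq_trans (size_polyD _ _) _.
    rewrite size_polyN geq_max (leq_trans (size_scale_leq _ _) szq) andbT.
    apply/leq_sizeP => i le_i; rewrite coefB coefZ coefXn.
    have [->|ne] := eqVneq i (size p).-1; first by rewrite mulr1 lead_coefE subrr.
    by rewrite mulr0 subr0 nth_default // -(prednK lt0) ltn_neqAle eq_sym ne.
  exists ((lead_coef p / z) *: 'X^j + y).
  by rewrite linearD opprD addrA.
exists (N + w)%N => p; have [q sq] := reach (ap (J ^+ (N + w)) p).
exists q; rewrite apM; have : ap (D ^+ (N + w)) (ap (J ^+ (N + w)) p - ap (diffop a) q) = 0.
  by rewrite apDn derivn_poly0.
rewrite linearB /= -!apM DJn // ap1 => /eqP.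
by rewrite subr_eq0 => /eqP <-.
Qed.

(** * Left ideals containing a polynomial in D *)

Definition rmul L u : set I1^o := [set r * u | r in L].
Definition rdiv L u : set I1^o := [set r : I1 | L (r * u)].

Lemma submod_rmul L u : submodule L -> submodule (rmul L u).
Proof.
move=> [L0 LL]; split; first by exists 0; rewrite ?mul0r.
move=> z _ _ [r Lr <-] [s Ls <-]; exists (z * r + s); first exact: LL.
by rewrite mulrDl -mulrA.
Qed.

Lemma submod_rdiv L u : submodule L -> submodule (rdiv L u).
Proof.
move=> [L0 LL]; split; first by rewrite /rdiv /= mul0r.
by move=> z r s Lr Ls; rewrite /rdiv /= mulrDl -mulrA; apply: LL.
Qed.

Lemma projOn_rmul L u : submodule L -> onto u -> projOn L <-> projOn (rmul L u).
Proof.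
move=> SL uP; apply: (projOn_inj_image (k := fun r : I1^o => r * u : I1^o) SL).
  by move=> z x y _ _; rewrite mulrDl -mulrA.
by move=> x _ /= e; exact: (onto_rreg uP e).
Qed.

Lemma rmul_rdiv L u : rmul (rdiv L u) u = L `&` rmul [set: I1^o] u.
Proof.
rewrite eqEsubset; split=> [_ [r Lr <-]|t [Lt [r _ e]]].
  by split=> //; exists r.
by exists r; rewrite // /rdiv /= e.
Qed.

Lemma dpoly_diffop_lead p a :
  exists2 c : {poly {poly K}}, dpoly p * diffop a = diffop c &
  (size c <= size a)%N /\ c`_(size a).-1 = lead_coef a * p.
Proof.
have [->|a0] := eqVneq a 0.
  by exists 0; rewrite ?diffop0 ?mulr0 // size_poly0 coef0 lead_coef0 mul0r.
have lt0 : (0 < size a)%N by rewrite size_poly_gt0.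
have [c sc e] := dpoly_diffop p a.
have sc' : (size c <= (size a).-1)%N by apply: leq_trans sc (leq_pred _).
have sd : (size (a^`() * (p^`())%:P)%R <= (size a).-1)%N.
  rewrite mulrC mul_polyC; apply: leq_trans (size_scale_leq _ _) _.
  by rewrite -ltnS prednK // lt_size_deriv.
exists (a * p%:P + a^`() * (p^`())%:P + c) => //; split; last first.
  rewrite !coefD coefMC [c`_ _]nth_default // addr0.
  by rewrite [X in _ + X]nth_default ?addr0.
apply: leq_trans (size_polyD _ _) _; rewrite geq_max (leq_trans sc' (leq_pred _)) andbT.
apply: leq_trans (size_polyD _ _) _; rewrite geq_max (leq_trans sd (leq_pred _)) andbT.
by rewrite mulrC mul_polyC size_scale_leq.
Qed.

Lemma exists_irreducible_factor p : (1 < size p)%N ->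
  exists2 q, irreducible_poly q & q %| p.
Proof.
move=> sp; have exn : exists n, `[< exists q, [/\ size q = n, (1 < n)%N & q %| p] >].
  by exists (size p); apply/asboolP; exists p.
case: (ex_minnP exn) => n /asboolP [q [sq n1 qp]] minn.
exists q => //; split; first by rewrite sq.
move=> s s1 sq'; have sp' := dvdp_trans sq' qp.
have p0 : p != 0 by rewrite -size_poly_gt0 ltnW.
have s_gt1 : (1 < size s)%N.
  by rewrite ltn_neqAle eq_sym s1 size_poly_gt0 (dvdpN0 sp' p0).
have q0 : q != 0 by rewrite -size_poly_gt0 sq ltnW.
rewrite -(dvdp_size_eqp sq') eqn_leq dvdp_leq //= sq minn //.
by apply/asboolP; exists s.
Qed.

Lemma irreducible_coprime q p :
  irreducible_poly q -> ~~ (q %| p) -> coprimep q p.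
Proof.
move=> [q1 qP] nqp; rewrite coprimep_def; apply: contraNT nqp => s1.
have := qP _ s1 (dvdp_gcdl q p) => /eqp_dvdl <-; exact: dvdp_gcdr.
Qed.

(** Modulo I1 q(D), the commutator with q(D) lowers the degree in X and
    multiplies the leading coefficient by n q', which is prime to q in
    characteristic zero. Descending to degree 0 yields a polynomial prime to
    q, hence 1. *)
Lemma mod_irreducible_descent L q a : submodule L -> irreducible_poly q ->
  (forall r, L (r * dpoly q)) -> L (diffop a) -> (exists i, ~~ (q %| a`_i)) -> L 1.
Proof.
move=> SL irq Lq; have [n] := ubnP (size a); elim: n a => // n IH a lt_n La [i nqi].
have a0 : a != 0 by apply: contraNneq nqi => ->; rewrite coef0 dvdp0.
have lt0 : (0 < size a)%N by rewrite size_poly_gt0.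
have [dv|ndv] := boolP (q %| lead_coef a).
  have [z ez] := dvdpP _ _ dv.
  pose a1 := a - (z * q)%:P * 'X^((size a).-1).
  apply: (IH a1).
  - rewrite ltnS in lt_n; apply: leq_trans lt_n; rewrite -(prednK lt0) ltnS.
    apply/leq_sizeP => j le_j; rewrite coefB coefCM coefXn -ez.
    have [->|ne] := eqVneq j (size a).-1; first by rewrite mulr1 lead_coefE subrr.
    by rewrite mulr0 subr0 nth_default // -(prednK lt0) ltn_neqAle eq_sym ne.
  - rewrite diffopB diffopMXn diffopC dpolyM mulrA; apply: (submodB SL) => //.
  - exists i; apply: contra nqi; rewrite coefB coefCM coefXn => h.
    rewrite -[a`_i](subrK (z * q * (i == (size a).-1)%:R)); apply: dvdp_add h _.
    by rewrite mulrAC dvdp_mulIr.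
have cop := irreducible_coprime irq ndv.
have [s1|s1] := eqVneq (size a) 1%N.
  have ea := size1_polyC (eq_leq s1).
  move: cop; rewrite lead_coefE s1 /= => /Bezout_eq1_coprimepP [[z w] /= e].
  rewrite -dpoly1 -e dpolyD; apply: (submodD SL); first by rewrite dpolyM.
  have ea' : diffop a = dpoly a`_0 by rewrite {1}ea diffopC.
  by rewrite dpolyM -ea'; apply: (submodZ (N := L)).
have [c sc e] := dpoly_diffop q a.
apply: (IH (a^`() * (q^`())%:P + c)).
- rewrite ltnS in lt_n; apply: leq_trans lt_n; rewrite -(prednK lt0) ltnS.
  apply: leq_trans (size_polyD _ _) _; rewrite geq_max; apply/andP; split.
    rewrite mulrC mul_polyC; apply: leq_trans (size_scale_leq _ _) _.
    by rewrite -ltnS prednK // lt_size_deriv.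
  by apply: leq_trans sc (leq_pred _).
- have -> : diffop (a^`() * (q^`())%:P + c) = dpoly q * diffop a - diffop a * dpoly q.
    by rewrite e -diffopMC -diffopB; congr diffop; ring.
  apply: (submodB SL) => //; exact: (submodZ (N := L)).
- exists (size a).-2.
  have s2 : (size a).-2.+1 = (size a).-1 by rewrite prednK // -ltnS prednK // ltn_neqAle eq_sym s1.
  rewrite coefD coefMC coef_deriv s2 [c`_ _]nth_default // addr0 -lead_coefE.
  have nd1 : ~~ (q %| lead_coef a *+ (size a).-1).
    rewrite -s2 -scaler_nat dvdpZr //; exact: natK_neq0.
  rewrite Gauss_dvdpr ?irreducible_coprime //.
  have q0 : q != 0 by rewrite -size_poly_gt0 ltnW // irq.1.
  have d0 : q^`() != 0.
    apply/eqP => /(deriv_eq0_const) eq'.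
    by move: irq.1; rewrite eq' size_polyC; case: (_ != 0).
  by apply/negP => /(dvdp_leq d0); rewrite leqNgt lt_size_deriv.
Qed.

(** Induction on p, with an irreducible factor q of p: either all coefficients
    of the differential operators in L are divisible by q, and L is a subset
    of I1 q(D) + F, or L + I1 q(D) is everything. *)
Lemma projOn_of_dpoly L p : submodule L -> F `<=` L -> p != 0 -> L (dpoly p) ->
  projOn L.
Proof.
move=> SL FL; have [n] := ubnP (size p).
elim: n p L SL FL => // n IH p L SL FL lt_n p0 Lp.
have [s1|s1] := leqP (size p) 1.
  have -> : L = [set: I1^o]; last exact: projOn_ring.
  rewrite eqEsubset; split=> // r _.
  have c0 : p`_0 != 0 by rewrite -polyC_eq0 -size1_polyC.
  have -> : r = (r * dpoly ((p`_0)^-1)%:P) * dpoly p.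
    by rewrite -mulrA -dpolyM {2}(size1_polyC s1) -polyCM mulVf // dpoly1 mulr1.
  exact: (submodZ (N := L)).
have [q irq /dvdpP [p1 ep]] := exists_irreducible_factor s1.
have q0 := irredp_neq0 irq.
have p10 : p1 != 0 by apply: contraNneq p0; rewrite ep => ->; rewrite mul0r.
have uq : onto (dpoly q) := onto_dpoly q0.
pose L3 := rdiv L (dpoly q).
have SL3 : submodule L3 := submod_rdiv (dpoly q) SL.
have PL3 : projOn L3.
  apply: (IH p1) => //.
  - by move=> f Ff; apply/FL/F_mulr.
  - move: lt_n; rewrite ep size_mul // ltnS; apply: leq_trans.
    have := irq.1; have : (0 < size p1)%N by rewrite size_poly_gt0.
    by move: (size p1) (size q) => x y; lia.
  - by rewrite /L3 /rdiv /= -dpolyM -ep.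
have PI : projOn (rmul L3 (dpoly q)) by apply/(projOn_rmul SL3 uq).
have SI : submodule (rmul L3 (dpoly q)) := submod_rmul (dpoly q) SL3.
have [div|/existsNP [a /not_implyP [La nd]]] :=
    pselect (forall a, L (diffop a) -> forall i, q %| a`_i).
  have -> : L = sumsub (rmul L3 (dpoly q)) F; last exact/(projOn_sum_F SI).
  rewrite eqEsubset; split; last first.
    by apply: sumsub_min => // _ [r Lr <-].
  move=> r Lr; have [k [a e]] := D_power_diffop r.
  have La : L (diffop a) by rewrite -e; apply: (submodZ (N := L)).
  pose b := \poly_(i < size a) (a`_i %/ q).
  have eb : a = b * q%:P.
    apply/polyP => i; rewrite coefMC coef_poly; case: ltnP => [_|le_i].
      by rewrite divpK // div.
    by rewrite mul0r nth_default.
  exists (J ^+ k * (D ^+ k * r)), (r - J ^+ k * (D ^+ k * r)); split.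
  - exists (J ^+ k * diffop b); last by rewrite -mulrA -diffopMC -eb e.
    by rewrite /L3 /rdiv /= -mulrA -diffopMC -eb; apply: (submodZ (N := L)).
  - exact: F_defect.
  - by rewrite addrC subrK.
have SR : submodule (rmul [set: I1^o] (dpoly q)) := submod_rmul (dpoly q) (submodT _).
apply: (projOn_sum_cap SL SR); last by rewrite -rmul_rdiv.
suff -> : sumsub L (rmul [set: I1^o] (dpoly q)) = [set: I1^o] by exact: projOn_ring.
have SS := submod_sum SL SR.
have S1 : sumsub L (rmul [set: I1^o] (dpoly q)) 1.
  apply: (mod_irreducible_descent SS irq (a := a)).
  - by move=> r; apply: (subset_sumsubr SL); exists r.
  - exact: (subset_sumsubl SR).
  - by move/existsNP: nd => [i /negP ?]; exists i.
rewrite eqEsubset; split=> // r _; rewrite -[r]mulr1.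
exact: (submodZ r SS S1).
Qed.

(** * Reduction of arbitrary left ideals *)

Lemma notF_onto r : ~ F r -> exists k, onto (D ^+ k * r).
Proof.
move=> nF; have [k [a e]] := D_power_diffop r.
have a0 : a != 0.
  by apply/eqP => a0; apply: nF; exists k; rewrite e a0 diffop0.
have [j jP] := onto_Dn_diffop a0.
by exists (j + k)%N; rewrite exprD -mulrA e.
Qed.

Lemma onto_notF r : onto r -> ~ F r.
Proof.
move=> rP [k e]; have /(_ 1) [q] : onto (D ^+ k * r).
  by apply: ontoM rP; apply: onto_Dn.
by rewrite e ap0 => /esym/eqP; rewrite oner_eq0.
Qed.

Lemma F_diffop a : F (diffop a) -> a = 0.
Proof.
move=> Fa; apply/eqP; apply: contrapT => /negP a0.
have [k kP] := onto_Dn_diffop a0.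
by apply: (onto_notF kP); apply/F_D.
Qed.

Section LeftIdeal.
Variable L : set I1^o.
Hypothesis SL : submodule L.

(** Pseudo-division by an element b of least degree leaves no remainder; each
    step costs one factor l(D), where l is the leading coefficient of b. *)
Lemma ideal_pseudo_division b : L (diffop b) -> b != 0 ->
  (forall a, L (diffop a) -> a != 0 -> (size b <= size a)%N) ->
  forall m a, L (diffop a) -> (size a < size b + m)%N ->
  exists q : {poly {poly K}}, (size q <= m)%N /\
    dpoly (lead_coef b) ^+ m * diffop a = diffop q * diffop b.
Proof.
move=> Lb b0 minb; elim=> [|m IH] a La.
  rewrite addn0 => lt_ab; exists 0; rewrite size_poly0; split=> //.
  have -> : a = 0 by apply: contraTeq lt_ab => a0; rewrite -leqNgt minb.
  by rewrite diffop0 mulr0 mul0r.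
rewrite addnS ltnS => le_a.
have lt0 : (0 < size b)%N by rewrite size_poly_gt0.
pose n := (size b).-1; pose al := a`_(n + m).
have [c ec [sc cc]] := dpoly_diffop_lead (lead_coef b) a.
have [d ed [sd cd]] := dpoly_diffop_lead al b.
pose a1 := c - d * 'X^m.
have ea1 : diffop a1 = dpoly (lead_coef b) * diffop a - X ^+ m * (dpoly al * diffop b).
  by rewrite diffopB diffopMXn -ec -ed.
have La1 : L (diffop a1).
  rewrite ea1 mulrA; apply: (submodB SL); exact: (submodZ _ SL).
have enm : (size b + m)%N = (n + m).+1 by rewrite -addSn prednK.
have lt_a1 : (size a1 < size b + m)%N.
  rewrite enm ltnS; apply/leq_sizeP => j le_j.
  rewrite coefB coefMXn ltnNge (leq_trans (leq_addl _ _) le_j) /=.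
  have [ej|ne] := eqVneq j (n + m)%N.
    rewrite ej addnK cd.
    have [lt_sa|] := ltnP (size a) (n + m).+1.
      rewrite nth_default; last by apply: leq_trans sc _.
      by rewrite /al nth_default // mulr0 subrr.
    rewrite -enm => ge_a; have sa : size a = (n + m).+1.
      by apply/eqP; rewrite eqn_leq -enm le_a ge_a.
    by move: cc; rewrite lead_coefE sa /= => ->; rewrite mulrC subrr.
  have lt_j : (n + m < j)%N by rewrite ltn_neqAle eq_sym ne.
  rewrite nth_default ?nth_default ?subrr //.
    by apply: leq_trans sd _; rewrite -(prednK lt0) -/n; lia.
  by apply: leq_trans sc _; apply: leq_trans le_a _; rewrite enm.
have [q [sq eq]] := IH a1 La1 lt_a1.
have [f ef [sf _]] := dpoly_diffop_lead (lead_coef b ^+ m) (al%:P * 'X^m).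
exists (q + f); split.
  apply: leq_trans (size_polyD _ _) _; rewrite geq_max leqW //=.
  apply: leq_trans sf _; rewrite mul_polyC.
  by apply: leq_trans (size_scale_leq _ _) _; rewrite size_polyXn.
rewrite diffopD mulrDl -eq -ef ea1 mulrBr exprSr -mulrA diffopMXn diffopC dpolyXE -!mulrA subrK.
by [].
Qed.

(** Choose a0 in L with leading coefficient of least degree. Every leading
    coefficient occurring in L, in degree at least that of a0, is then
    divisible by the one of a0, so that multiples of a0 reduce everything to
    degrees at most that of a0. *)
Lemma ideal_bounded_generation : exists N, forall T : set I1^o,
  submodule T -> F `<=` T ->
  (forall a, L (diffop a) -> (size a <= N)%N -> T (diffop a)) -> L `<=` T.
Proof.
have toT (T : set I1^o) : submodule T -> F `<=` T ->
    (forall a, L (diffop a) -> T (diffop a)) -> L `<=` T.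
  move=> ST FT opT r Lr; have [k [a e]] := D_power_diffop r.
  rewrite -[r](subrK (J ^+ k * (D ^+ k * r))); apply: (submodD ST).
    exact/FT/F_defect.
  apply: (submodZ _ ST); rewrite e; apply: opT; rewrite -e.
  exact: (submodZ _ SL).
have [[a1 [La1 a10]]|none] := pselect (exists a, L (diffop a) /\ a != 0); last first.
  exists 0%N => T ST FT _; apply: toT => // a La.
  have -> : a = 0 by apply: contrapT => /eqP a0; apply: none; exists a.
  by rewrite diffop0; apply: ST.1.
have exd : exists d, `[< exists a, [/\ L (diffop a), a != 0 & size (lead_coef a) = d] >].
  by exists (size (lead_coef a1)); apply/asboolP; exists a1.
case: (ex_minnP exd) => d /asboolP [a0 [La0 a00 sd]] mind.
exists (size a0) => T ST FT opT; apply: toT => // a.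
have [n] := ubnP (size a); elim: n a => // n IH a lt_n La.
have [le_a|lt_a] := leqP (size a) (size a0); first exact: opT.
pose k := (size a - size a0)%N; pose ch := lead_coef a %/ lead_coef a0.
have [c ec [sc cc]] := dpoly_diffop_lead ch a0.
have Lc : L (diffop c) by rewrite -ec; apply: (submodZ _ SL).
pose b := a - c * 'X^k.
have eb : diffop b = diffop a - X ^+ k * diffop c by rewrite diffopB diffopMXn.
have Lb : L (diffop b) by rewrite eb; apply: (submodB SL) => //; apply: (submodZ _ SL).
have lt0 : (0 < size a0)%N by rewrite size_poly_gt0.
have lt0a : (0 < size a)%N by apply: leq_ltn_trans lt_a.
have sb : (size b <= size a)%N.
  apply: leq_trans (size_polyD _ _) _; rewrite geq_max leqnn size_polyN /=.
  have [->|c0] := eqVneq c 0; first by rewrite mul0r size_poly0.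
  rewrite size_Mmonic ?monicXn // size_polyXn addnS /= addnC /k; apply: leq_trans (leq_add (leqnn _) sc) _.
  by rewrite subnK // ltnW.
have cb : b`_(size a).-1 = lead_coef a %% lead_coef a0.
  have e1 : ((size a).-1 - k = (size a0).-1)%N by rewrite /k; lia.
  have e2 : ((size a).-1 < k)%N = false by rewrite /k; lia.
  rewrite coefB coefMXn e2 e1 cc -lead_coefE /ch {1}(divp_eq (lead_coef a) (lead_coef a0)).
  by rewrite [_ * lead_coef a0]mulrC [X in X - _]addrC addrK.
have lt_b : (size b < size a)%N.
  rewrite ltn_neqAle sb andbT; apply/eqP => esb.
  have b0 : b != 0 by rewrite -size_poly_gt0 esb.
  have lead0 : lead_coef a0 != 0 by rewrite lead_coef_eq0.
  have : (d <= size (lead_coef b))%N by apply: mind; apply/asboolP; exists b.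
  by rewrite lead_coefE esb cb -sd leqNgt ltn_modp lead0.
have -> : diffop a = X ^+ k * diffop c + diffop b by rewrite eb addrC subrK.
apply: (submodD ST); last by apply: IH => //; apply: leq_trans lt_b _.
rewrite -ec; do 2!apply: (submodZ _ ST); exact: opT.
Qed.

End LeftIdeal.

(** Pseudo-division gives l(D)^m a = q b for all generators a of bounded
    degree, with one exponent m and with q of degree less than m in X. The
    powers of l(D) in u and g are what [diffop_dpoly_power] needs to move
    l(D)^(2m) to the left across b, and then l(D)^m to the left across q;
    cancelling l(D)^m on the left gives a u in I1 v + F. *)
Lemma common_denominator L : submodule L -> ~ L `<=` F ->
  exists b g u v, [/\ L (diffop b), b != 0, g != 0 & [/\ onto u,
    diffop b * u = dpoly g * v & L `<=` rdiv (sumsub (rmul [set: I1^o] v) F) u]].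
Proof.
move=> SL nLF.
have exb : exists n, `[< exists b, [/\ L (diffop b), b != 0 & size b = n] >].
  move/existsNP: nLF => [r /not_implyP [Lr nFr]].
  have [k [b e]] := D_power_diffop r; exists (size b); apply/asboolP.
  exists b; split=> //; first by rewrite -e; apply: (submodZ _ SL).
  by apply/eqP => b0; apply: nFr; exists k; rewrite e b0 diffop0.
case: (ex_minnP exb) => n /asboolP [b [Lb b0 sb]] minb.
have [N genN] := ideal_bounded_generation SL.
pose l := lead_coef b; pose m := N.+1.
have l0 : l != 0 by rewrite lead_coef_eq0.
have [v ev] := diffop_dpoly_power l (m + m) b.
exists b, (l ^+ (m + m)), (dpoly l ^+ (m + m + size b)), v.
split=> //; first exact: expf_neq0.
split; first by rewrite -dpolyXE; apply: onto_dpoly => //; apply: expf_neq0.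
  by rewrite ev dpolyXE.
have SRv := submod_rmul v (submodT (I1^o : lmodType I1)).
apply: genN.
- exact/submod_rdiv/submod_sum.
- by move=> f Ff; apply: (subset_sumsubr SRv); apply: F_mulr.
move=> a La le_a.
have [q [sq eq]] : exists q : {poly {poly K}}, (size q <= m)%N /\
    dpoly l ^+ m * diffop a = diffop q * diffop b.
  apply: (ideal_pseudo_division SL Lb b0) => //.
    by move=> c Lc c0; rewrite sb; apply: minb; apply/asboolP; exists c.
  by rewrite /m addnS ltnS (leq_trans le_a) // leq_addl.
have [y ey] := diffop_dpoly_power l m q.
pose z := y * dpoly l ^+ (m - size q).
exists (z * v), (diffop a * dpoly l ^+ (m + m + size b) - z * v).
split; first by exists z.
  apply: (F_dpoly (g := l ^+ m)); first exact: expf_neq0.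
  exists 0%N; rewrite mul1r dpolyXE mulrBr mulrA eq -mulrA ev.
  have -> : (m + m = (m + size q) + (m - size q))%N by rewrite -addnA subnKC.
  by rewrite [dpoly l ^+ (_ + (m - _))]exprD !mulrA ey subrr.
by rewrite addrC subrK.
Qed.

(** With L u contained in I1 v + F and b u = g(D) v, the left ideal L1 of the
    r such that r w lies in L u + F contains g(D), where w = D^j v, and
    L1 w + F = L u + F. *)
Lemma left_hereditary_I1 : left_hereditary I1.
Proof.
move=> L0 SL0; apply/(projOn_sum_F SL0).
set L := sumsub L0 F; have SL : submodule L := submod_sum SL0 SF.
have FL : F `<=` L by apply: subset_sumsubr.
have [LF|nLF] := pselect (L `<=` F); first exact: projOn_sub_F.
have [b [g [u [v [Lb b0 g0 [uP ebu Lu]]]]]] := common_denominator SL nLF.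
have nFv : ~ F v.
  move=> Fv; have [k e] : F (diffop b * u) by rewrite ebu; apply: (submodZ _ SF).
  have Fb : F (diffop b) by exists k; apply: (onto_rreg uP); rewrite -mulrA.
  by move: b0; rewrite (F_diffop Fb) eqxx.
(* D^j v generates the same left ideal as v modulo F, and right multiplication
   by it is injective. *)
have [j vP] := notF_onto nFv; pose w := D ^+ j * v.
have SLu := submod_rmul u SL; have SLuF := submod_sum SLu SF.
pose L1 := rdiv (sumsub (rmul L u) F) w.
have SL1 : submodule L1 := submod_rdiv w SLuF.
have PL1 : projOn L1.
  apply: (projOn_of_dpoly SL1 _ g0).
    by move=> f Ff; apply: (subset_sumsubr SLu); apply: F_mulr.
  apply: (subset_sumsubl SF); exists (D ^+ j * diffop b); first exact: (submodZ _ SL).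
  by rewrite -mulrA ebu /w !mulrA -dpolyXn dpoly_comm.
have e : sumsub (rmul L1 w) F = sumsub (rmul L u) F.
  rewrite eqEsubset; split; apply: sumsub_min => //.
  - by move=> _ [r Lr <-].
  - exact: subset_sumsubr.
  - exact/submod_sum/SF/submod_rmul.
  - move=> _ [r Lr <-]; have [_ [f [[y _ <-] Ff eru]]] := Lu _ Lr.
    pose f' := y * (v - J ^+ j * w) + f.
    have Ff' : F f'.
      by apply: (submodD SF) => //; apply: (submodZ _ SF); apply: F_defect.
    have eru' : r * u = y * J ^+ j * w + f'.
      by rewrite eru /f' mulrBr !mulrA !addrA; congr (_ + _); rewrite addrAC subrr add0r.
    exists (y * J ^+ j * w), f'; split=> //; exists (y * J ^+ j) => //.
    rewrite /L1 /rdiv /=; exists (r * u), (- f'); split; first by exists r.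
      exact: submodN.
    by rewrite eru' addrK.
  - by apply: subset_sumsubr; apply: submod_rmul.
apply/(projOn_rmul SL uP)/(projOn_sum_F SLu); rewrite -e.
apply/(projOn_sum_F (submod_rmul w SL1)).
exact/(projOn_rmul SL1 vP).
Qed.

End IntegroDifferential.

Theorem theorem1p1 (K : fieldType) (charK0 : [pchar K] =i pred0) :
  lgldim (Q_l (I1 K)) = Some 1%N /\
  (forall (S : set (I1 K)) (HS : regular_left_Ore S),
     lgldim (lfrac HS) = Some 1%N).
Proof.
suff fracs (S : set (I1 K)) (HS : regular_left_Ore S) : lgldim (lfrac HS) = Some 1%N.
  by split=> //; apply: fracs.
have fP := lfracP HS.
set f : {rmorphism I1 K -> lfrac HS} := tolfrac HS in fP.
apply: (lgldim_hereditary_eq1 (p := f (I1D K)) (q := f (I1int K))).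
- exact: left_hereditary_fractions HS fP (left_hereditary_I1 charK0).
- by rewrite -rmorphM (DJ charK0) rmorph1.
- move=> e; have [_ _ kerf] := fP.
  have /kerf [s Ss] : f (I1int K * I1D K - 1) = 0.
    by rewrite rmorphB rmorphM e rmorph1 subrr.
  rewrite -[RHS](mulr0 s) => /(HS.2 _ Ss).1 /eqP.
  by rewrite subr_eq0 => /eqP /JD_neq1.
Qed.
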